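(* Let $I,J$ be finite nonempty index sets and let $(P,Q)=((P_n,Q_n))_{n\in\mathbb N}$ be an approximately geometric sequence in the semiring of pairs of families of measures with full support equipped with the relative submajorization preorder, where all $P_{n,i}$ ($i\in I$) and $Q_{n,j}$ ($j\in J$) are probability distributions. Then for all $\alpha\in[1,\infty]$, $i\in I$, and $\gamma\in\mathcal P(J)$ the multivariate R\'enyi divergence rates \[\overline D_{\alpha,i,\gamma}(P,Q):=\lim_{n\to\infty}\frac1nD_{\alpha,i,\gamma}(P_n,Q_n)=\frac{1}{\alpha-1}\log_2\overline{f_{\alpha,i,\gamma}}(P,Q)\] exist (the last expression being meant for $1<\alpha<\infty$), where $\overline{f_{\alpha,i,\gamma}}(P,Q)=\lim_{n\to\infty}\sqrt[n]{f_{\alpha,i,\gamma}(P_n,Q_n)}$, and the optimal strong converse exponent $R^*(r)$ for the type I error as a function of the decay rate $r$ of the type II error probability is \[R^*(r)=\sup_{\alpha\ge1}\max_{\substack{i\in I\\ \gamma\in\mathcal P(J)}}\frac{\alpha-1}{\alpha}\left[r-\overline D_{\alpha,i,\gamma}(P,Q)\right].\]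
   Context: Semiring: elements are equivalence classes (under bijections of the underlying set) of pairs $(P,Q)$ of families $P=(P_i)_{i\in I}$, $Q=(Q_j)_{j\in J}$ of measures with full support on a common finite set $\mathcal X$ (varying with the element). Addition is direct sum (disjoint union of underlying sets), multiplication $\otimes$ is the product of measures taken componentwise; zero is the pair on $\mathcal X=\emptyset$, the unit is $((1,\dots,1),(1,\dots,1))$ on a singleton. Relative submajorization preorder: $(P,Q)\ge(P',Q')$ iff there is a column-substochastic matrix $T$ with $P'_i\le TP_i$ and $Q'_j\ge TQ_j$ entrywise for all $i,j$ (zero matrices with $0$ rows are allowed). The element $u=((2,\dots,2),(1,\dots,1))$ on a singleton is power universal, meaning that $1\le u$ and for all nonzero $x\le y$ there is $k\in\mathbb N$ with $y\le u^{\otimes k}\otimes x$. $\mathbb N$ includes $0$; a sublinear sequence is a sequence $(k_n)_{n\in\mathbb N}$ in $\mathbb N$ with $k_n/n\to0$. A sequence $(a_n)_{n\in\mathbb N}$ of nonzero elements is approximately geometric if there is a sublinear sequence $(k_n)$ such that for all $t\in\mathbb N_{>0}$ and $n_1,\dots,n_t\in\mathbb N$ both $a_{n_1}\otimes\cdots\otimes a_{n_t}\le u^{\otimes(k_{n_1}+\dots+k_{n_t})}\otimes a_{n_1+\dots+n_t}$ and $a_{n_1+\dots+n_t}\le u^{\otimes(k_{n_1}+\dots+k_{n_t})}\otimes a_{n_1}\otimes\cdots\otimes a_{n_t}$ hold. $\mathcal P(J)$ is the set of probability distributions on $J$. For $\alpha\ge1$, $i\in I$, $\gamma\in\mathcal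 P(J)$: $f_{\alpha,i,\gamma}(P,Q)=\sum_{x\in\mathcal X}P_i(x)^\alpha\prod_{j\in J}Q_j(x)^{(1-\alpha)\gamma(j)}$. The multivariate R\'enyi divergence $D_{\alpha,i,\gamma}(P,Q)$ is the R\'enyi divergence of order $\alpha$ of $P_i$ relative to the measure $x\mapsto\prod_{j\in J}Q_j(x)^{\gamma(j)}$: for $1<\alpha<\infty$, $D_{\alpha,i,\gamma}(P,Q)=\frac1{\alpha-1}\log_2f_{\alpha,i,\gamma}(P,Q)$; for $\alpha=1$ it is the relative entropy $D_{1,i,\gamma}(P,Q)=\sum_{x\in\mathcal X}P_i(x)\log_2\frac{P_i(x)}{\prod_{j\in J}Q_j(x)^{\gamma(j)}}$ (the limit $\alpha\to1$); and $D_{\infty,i,\gamma}(P,Q)=\lim_{\alpha\to\infty}D_{\alpha,i,\gamma}(P,Q)=\log_2\max_{x\in\mathcal X}P_i(x)\prod_{j\in J}Q_j(x)^{-\gamma(j)}$. Hypothesis testing: the null hypothesis is that the $n$-th sample is distributed according to one of the $P_{n,i}$ ($i\in I$), the alternative that it is distributed according to one of the $Q_{n,j}$ ($j\in J$). A (randomized) test $T_n$ is a row vector with entries in $[0,1]$ indexed by the underlying set $\mathcal X_n$ (the probabilities of accepting the null hypothesis). Its worst-case type I and type II error probabilities are $\alpha_n(T_n)=\max_{i\in I}(1-T_nP_{n,i})$ and $\beta_n(T_n)=\max_{j\in J}T_nQ_{n,j}$. For $r\ge0$, the optimal strong converse exponent $R^*(r)$ is the smallest $R$ such that there is a sequence of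 tests with $\beta_n(T_n)\le2^{-nr+o(n)}$ and $1-\alpha_n(T_n)\ge2^{-nR+o(n)}$.
   Formalization: At α=1 the limit of D_1(P_n,Q_n)/n need not exist for approximately geometric sequences, so the order-1 rate is instead the limit of the rates as α decreases to 1, whose existence is proved; rates for 1<α≤∞ and the formula for R*(r) are as stated. *)

(* Defs.v *)
From HB Require Import structures.
From mathcomp Require Import all_boot all_order all_algebra.
From mathcomp Require Import all_classical all_reals all_analysis.
Set Implicit Arguments.
Unset Strict Implicit.
Unset Printing Implicit Defensive.
Import Order.TTheory GRing.Theory Num.Theory.
Import numFieldNormedType.Exports.
Local Open Scope classical_set_scope.
Local Open Scope ring_scope.

(* A representative of an element of the semiring, whose elements are classes
   of such pairs up to bijections of the underlying set; every notion below is
   invariant under these bijections. *)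
Record fampair (R : realType) (I J : finType) := Fampair {
  carrier : finType;
  nullP : I -> carrier -> R;
  altQ : J -> carrier -> R;
  nullP_gt0 : forall i x, 0 < nullP i x;
  altQ_gt0 : forall j x, 0 < altQ j x }.

Section Semiring.
Variables (R : realType) (I J : finType).
Implicit Types p q : fampair R I J.

Definition fp_one : fampair R I J :=
  @Fampair R I J unit (fun _ _ => 1) (fun _ _ => 1)
    (fun _ _ => ltr01) (fun _ _ => ltr01).

Definition fp_u : fampair R I J :=
  @Fampair R I J unit (fun _ _ => 2) (fun _ _ => 1)
    (fun _ _ => ltr0Sn R 1) (fun _ _ => ltr01).

Definition fp_tensor p q : fampair R I J :=
  @Fampair R I J (carrier p * carrier q)%type
    (fun i z => nullP i z.1 * nullP i z.2)
    (fun j z => altQ j z.1 * altQ j z.2)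
    (fun i z => mulr_gt0 (nullP_gt0 i z.1) (nullP_gt0 i z.2))
    (fun j z => mulr_gt0 (altQ_gt0 j z.1) (altQ_gt0 j z.2)).

Definition fp_prod (s : seq (fampair R I J)) : fampair R I J :=
  foldr fp_tensor fp_one s.

Definition fp_upow (k : nat) : fampair R I J := fp_prod (nseq k fp_u).

Definition substochastic (X Y : finType) (T : Y -> X -> R) : Prop :=
  (forall y x, 0 <= T y x) /\ (forall x, \sum_y T y x <= 1).

(* fp_le q p is q <= p: p relatively submajorizes q. *)
Definition fp_le q p : Prop :=
  exists T : carrier q -> carrier p -> R,
    [/\ substochastic T,
        forall i y, nullP i y <= \sum_x T y x * nullP i x &
        forall j y, \sum_x T y x * altQ j x <= altQ j y].

Definition sublinear (k : nat -> nat) : Prop :=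
  (k n)%:R / n%:R @[n --> \oo] --> (0 : R).

Definition approximately_geometric (a : nat -> fampair R I J) : Prop :=
  (forall n, (0 < #|carrier (a n)|)%N) /\
  exists k : nat -> nat, sublinear k /\
    forall s : seq nat, (0 < size s)%N ->
      let aprod := fp_prod [seq a n | n <- s] in
      let asum := a (\sum_(n <- s) n)%N in
      let ufac := fp_upow (\sum_(n <- s) k n)%N in
      fp_le aprod (fp_tensor ufac asum) /\ fp_le asum (fp_tensor ufac aprod).

End Semiring.

Definition is_distr (R : realType) (X : finType) (g : X -> R) : Prop :=
  (forall x, 0 <= g x) /\ \sum_x g x = 1.

Definition log2 (R : realType) (x : R) : R := ln x / ln 2.

Section Renyi.
Variables (R : realType) (I J : finType).
Implicit Types (p : fampair R I J) (a : nat -> fampair R I J).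

Definition renyi_f (alpha : R) (i : I) (gamma : J -> R) p : R :=
  \sum_(x : carrier p) nullP i x `^ alpha * \prod_j altQ j x `^ ((1 - alpha) * gamma j).

(* The order ranges over [1, +oo]; the value at -oo is a dummy. In the case
   +oo the maximum is over positive reals, so that 0 is a harmless default. *)
Definition renyi_div (alpha : \bar R) (i : I) (gamma : J -> R) p : R :=
  match alpha with
  | al%:E =>
      if al == 1 then
        \sum_(x : carrier p) nullP i x * log2 (nullP i x / \prod_j altQ j x `^ gamma j)
      else (al - 1)^-1 * log2 (renyi_f al i gamma p)
  | +oo%E => log2 (\big[Num.max/0]_(x : carrier p)
               (nullP i x * \prod_j altQ j x `^ (- gamma j)))
  | -oo%E => 0
  end.

Definition renyi_seq a (alpha : \bar R) (i : I) (gamma : J -> R) : nat -> R :=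
  fun n => n%:R^-1 * renyi_div alpha i gamma (a n).

Definition renyi_f_root a (alpha : R) (i : I) (gamma : J -> R) : nat -> R :=
  fun n => renyi_f alpha i gamma (a n) `^ n%:R^-1.

Definition renyi_f_rate a (alpha : R) (i : I) (gamma : J -> R) : R :=
  limn (renyi_f_root a alpha i gamma).

(* At order 1 the rate is the limit of the rates of orders decreasing to 1:
   the sequence of normalized relative entropies need not converge for an
   approximately geometric sequence. For instance, for I and J singletons, take
   P_n = (w_n, 1 - w_n) and Q_n = (2^-(n+1), 1 - 2^-(n+1)) with w_n alternating
   between 1/4 and 1/2: this is approximately geometric with k_n = 3, and
   D_1(P_n, Q_n) / n = w_n + O(1/n). *)
Definition renyi_rate a (alpha : \bar R) (i : I) (gamma : J -> R) : R :=
  if alpha == 1%E then lim ((limn (renyi_seq a b%:E i gamma)) @[b --> (1 : R)^'+])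
  else limn (renyi_seq a alpha i gamma).

End Renyi.

Section Testing.
Variables (R : realType) (I J : finType).
Implicit Types (p : fampair R I J) (a : nat -> fampair R I J).

Definition is_test p (t : carrier p -> R) : Prop := forall x, 0 <= t x <= 1.

(* For tests on probability distributions the maxima are over elements of
   [0, 1], so that the default value 0 is harmless for nonempty I and J. *)
Definition typeI_error p (t : carrier p -> R) : R :=
  \big[Num.max/0]_(i : I) (1 - \sum_x t x * nullP i x).

Definition typeII_error p (t : carrier p -> R) : R :=
  \big[Num.max/0]_(j : J) \sum_x t x * altQ j x.

Definition little_o_n (e : nat -> R) : Prop := e n / n%:R @[n --> \oo] --> (0 : R).

Definition achievable a (r S : R) : Prop :=
  exists t : forall n, carrier (a n) -> R,
    (forall n, is_test (t n)) /\
    exists e e' : nat -> R,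
      [/\ little_o_n e, little_o_n e',
          forall n, typeII_error (t n) <= 2 `^ (- (n%:R * r) + e n) &
          forall n, 2 `^ (- (n%:R * S) + e' n) <= 1 - typeI_error (t n)].

Definition strong_converse_exponent a (r S : R) : Prop :=
  achievable a r S /\ forall S', achievable a r S' -> S <= S'.

End Testing.

Definition is_maximum (R : realType) (A : set R) (m : R) : Prop :=
  A m /\ ubound A m.

(* Main.v *)
(* Data processing makes [f_{alpha,i,gamma}], and its limit at order infinity,
   monotone and multiplicative functionals, so that log f(a_n) is additive up to
   an error alpha * k_n: the rates exist, uniformly in gamma, and a test, seen as
   a map to a point, bounds the exponent from below.

   Conversely it suffices to test powers of a fixed block a_m, since a_n is close
   to a power of a_m up to u^(n k_m / m). For one block and one i, Lagrange duality
   over distributions lambda, with multipliers theta of total mass at most c < 1,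
   turns the bound on all (alpha - 1) / alpha * (r - D_{alpha,i,gamma}) into a
   single lambda such that KL(lambda | P_i) and r + KL(lambda | P_i) - KL(lambda | Q_j)
   are all at most S / c up to small errors; here alpha = 1 / (1 - sum theta) and
   gamma = theta / sum theta. Sampling from lambda^t and damping the likelihood
   ratio lambda^t / P_i^t gives the test. *)

Require Import Defs.
From HB Require Import structures.
From mathcomp Require Import all_boot all_order all_algebra.
From mathcomp Require Import all_classical all_reals all_analysis.
From mathcomp Require Import ring lra.
Set Implicit Arguments.
Unset Strict Implicit.
Unset Printing Implicit Defensive.
Import Order.TTheory GRing.Theory Num.Theory.
Import numFieldNormedType.Exports.
Local Open Scope classical_set_scope.
Local Open Scope ring_scope.

(** In the Lagrangian [lambda * ln lambda] has coefficient [1 - sum theta]. Convexity in [lambda]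
    and a minimiser in closed form thus need multipliers of mass below 1, mass 1 being order
    infinity. A compact set of multipliers then requires a fixed bound [c < 1], whose cost [1 / c]
    is made small by taking [c] close to 1.

    The other difficulty is uniformity in the order, which ranges over a noncompact set: a block
    [a_m] determines the rate of order [alpha] only up to [alpha / (alpha - 1) * k_m / m], which
    explodes at 1. The factor [(alpha - 1) / alpha] in the exponent cancels this exactly, so one
    block serves all orders.

    Order 1 always contributes the value 0. Its rate, obtained as a monotone limit, therefore never
    enters the exponent. *)

Lemma le_of_eq {d} {T : porderType d} (x y : T) : x = y -> (x <= y)%O.
Proof. by move=> ->. Qed.

(** * Convexity of the exponential and Gibbs' inequality *)

Section Jensen.
Context {R : realType}.

Lemma jensen_expR {X : finType} (w u : X -> R) : is_distr w ->
  expR (\sum_x w x * u x) <= \sum_x w x * expR (u x).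
Proof.
move=> [w0 w1]; set s := \sum_x w x * u x.
(* The tangent line of [expR] at the mean [s] averages to [expR s], its linear part being centred
   under [w]. *)
have -> : expR s = \sum_x w x * (expR s * (1 + (u x - s))).
  rewrite (eq_bigr (fun x => expR s * (w x * (1 - s)) + expR s * (w x * u x)));
    last by move=> x _; ring.
  by rewrite big_split /= -!mulr_sumr -mulr_suml w1 -/s; ring.
apply: ler_sum => x _; apply: ler_wpM2l => //.
rewrite -{2}(subrK s (u x)) expRD mulrC; apply: ler_wpM2r; first exact: expR_ge0.
exact: expR_ge1Dx.
Qed.

Lemma jensen2_expR (s u v : R) : 0 <= s -> s <= 1 ->
  expR (s * u + (1 - s) * v) <= s * expR u + (1 - s) * expR v.
Proof.
move=> s0 s1.
pose w b : R := if b then s else 1 - s.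
have w_distr : is_distr w.
  split; first by case; rewrite /w //= subr_ge0.
  by rewrite big_bool /w /=; ring.
by have := jensen_expR (fun b => if b then u else v) w_distr; rewrite !big_bool.
Qed.

(** Jensen's inequality for the log-ratios [ln (v x / w x)], whose exponentials have [w]-mean
    [\sum_x v x <= 1]. *)
Lemma gibbs {X : finType} (w v : X -> R) : is_distr w ->
  (forall x, 0 < w x) -> (forall x, 0 < v x) -> \sum_x v x <= 1 ->
  0 <= \sum_x w x * (ln (w x) - ln (v x)).
Proof.
move=> wd w0 v0 v1.
have := jensen_expR (fun x => ln (v x) - ln (w x)) wd.
rewrite [leRHS](eq_bigr v); last first.
  by move=> x _; rewrite expRB !lnK ?posrE // mulrC divfK // gt_eqF.
move=> /le_trans/(_ v1); rewrite -[1 in X in X -> _]expR0 ler_expR => h.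
rewrite -oppr_le0 -sumrN; apply: le_trans h.
by apply: ler_sum => x _; rewrite -mulrN opprB.
Qed.

End Jensen.

Lemma big_unit {T : Type} (x0 : T) (op : T -> T -> T) (F : unit -> T) :
  \big[op/x0]_t F t = op (F tt) x0.
Proof. by rewrite /index_enum !unlock. Qed.

(** * Renyi quantities as monotone multiplicative functionals *)

Section SpectralPoints.
Context {R : realType} {I J : finType}.
Implicit Types (p q : fampair R I J) (i : I) (gamma : J -> R).

Definition geomean gamma p (x : carrier p) : R :=
  expR (\sum_j gamma j * ln (altQ j x)).

Lemma prod_powR_geomean c gamma p (x : carrier p) :
  \prod_j altQ j x `^ (c * gamma j) = expR (c * \sum_j gamma j * ln (altQ j x)).
Proof.
rewrite mulr_sumr expR_sum; apply: eq_bigr => j _.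
by rewrite /powR gt_eqF ?altQ_gt0 // mulrA.
Qed.

(** The exponent is affine in [alpha] and in [gamma] separately; multiplicativity, continuity in
    [gamma] and the link with exponential tilting are read off from it. *)
Lemma renyi_fE alpha i gamma p : renyi_f alpha i gamma p =
  \sum_(x : carrier p)
    expR (alpha * ln (nullP i x) + (1 - alpha) * \sum_j gamma j * ln (altQ j x)).
Proof.
apply: eq_bigr => x _.
by rewrite prod_powR_geomean expRD /powR gt_eqF ?nullP_gt0.
Qed.

Lemma renyi_f_tensor alpha i gamma p q : renyi_f alpha i gamma (fp_tensor p q) =
  renyi_f alpha i gamma p * renyi_f alpha i gamma q.
Proof.
rewrite !renyi_fE big_distrlr /= pair_bigA /=; apply: eq_bigr => z _.
rewrite -expRD lnM ?posrE ?nullP_gt0 //.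
rewrite [X in (1 - alpha) * X](eq_bigr (fun j => gamma j * ln (altQ j z.1) +
  gamma j * ln (altQ j z.2))); last first.
  by move=> j _; rewrite lnM ?posrE ?altQ_gt0 // mulrDr.
by rewrite big_split /=; congr expR; ring.
Qed.

Lemma renyi_f_one alpha i gamma : renyi_f alpha i gamma (fp_one R I J) = 1.
Proof.
rewrite renyi_fE big_unit addr0 /= ln1 big1 => [|j _]; last by rewrite mulr0.
by rewrite !mulr0 addr0 expR0.
Qed.

Lemma renyi_f_u alpha i gamma : renyi_f alpha i gamma (fp_u R I J) = expR (alpha * ln 2).
Proof.
rewrite renyi_fE big_unit addr0 /= big1 => [|j _]; last by rewrite ln1 mulr0.
by rewrite mulr0 addr0.
Qed.

Lemma renyi_f_gt0 alpha i gamma p : (0 < #|carrier p|)%N -> 0 < renyi_f alpha i gamma p.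
Proof.
move=> /card_gt0P[x _]; rewrite renyi_fE (bigD1 x) //=.
by apply: ltr_wpDr; [apply: sumr_ge0 => y _; exact: expR_ge0|exact: expR_gt0].
Qed.

(* The tangent hyperplane at [b] of the geometric mean bounds it from above;
   after the weighted sum over [x] it is compared with the geometric mean [b]
   of the processed measures. *)
Lemma geomean_le gamma p (w : carrier p -> R) (b : J -> R) :
  is_distr gamma -> (forall x, 0 <= w x) -> (forall j, 0 < b j) ->
  (forall j, \sum_x w x * altQ j x <= b j) ->
  \sum_x w x * geomean gamma x <= expR (\sum_j gamma j * ln (b j)).
Proof.
move=> gd w0 b0 wb; set B := expR _.
have le (x : carrier p) : geomean gamma x <= \sum_j B * (gamma j / b j) * altQ j x.
  have := jensen_expR (fun j => ln (altQ j x) - ln (b j)) gd.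
  rewrite (eq_bigr (fun j => gamma j * ln (altQ j x) - gamma j * ln (b j)));
    last by move=> j _; ring.
  rewrite sumrB expRB ler_pdivrMr ?expR_gt0 // => /le_trans; apply.
  rewrite mulr_suml; apply: ler_sum => j _.
  by rewrite expRB !lnK ?posrE ?altQ_gt0 // -/B; apply: le_of_eq; ring.
have [g0 g1] := gd.
apply: (@le_trans _ _ (\sum_x \sum_j B * (gamma j / b j) * (w x * altQ j x))).
  apply: ler_sum => x _; apply: (le_trans (ler_wpM2l (w0 x) (le x))).
  by rewrite mulr_sumr; apply: ler_sum => j _; rewrite mulrCA.
rewrite exchange_big /= -[leRHS]mulr1 -[X in _ <= _ * X]g1 mulr_sumr.
apply: ler_sum => j _; rewrite -mulr_sumr -mulrA; apply: ler_wpM2l.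
  exact: expR_ge0.
rewrite mulrAC -mulrA -[leRHS]mulr1 ler_wpM2l //.
by rewrite ler_pdivrMr // mul1r.
Qed.

(* By Jensen's inequality [P^alpha g^(1-alpha)] lies above its tangent plane
   [alpha P c^(alpha-1) - (alpha-1) g c^alpha], for the slope [c = e^l] of the
   processed pair. *)
Lemma renyi_f_le alpha i gamma q p : 1 <= alpha -> is_distr gamma ->
  fp_le q p -> renyi_f alpha i gamma q <= renyi_f alpha i gamma p.
Proof.
move=> a1 gd [T [[T0 T1] TP TQ]]; have a0 : 0 < alpha by exact: lt_le_trans a1.
rewrite !renyi_fE.
apply: (@le_trans _ _ (\sum_y \sum_x T y x *
  expR (alpha * ln (nullP i x) + (1 - alpha) * \sum_j gamma j * ln (altQ j x))));
  last first.
  rewrite exchange_big /=; apply: ler_sum => x _; rewrite -mulr_suml.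
  by rewrite ler_piMl ?expR_ge0.
apply: ler_sum => y _.
set b := \sum_j gamma j * ln (altQ j y).
set l := ln (nullP i y) - b.
have tangent (x : carrier p) : alpha * expR ((alpha - 1) * l) * nullP i x -
    (alpha - 1) * expR (alpha * l) * geomean gamma x <=
    expR (alpha * ln (nullP i x) + (1 - alpha) * \sum_j gamma j * ln (altQ j x)).
  set g := \sum_j gamma j * ln (altQ j x).
  (* With weight [1 / alpha] the [g] terms of the two exponents cancel, which leaves the logarithm
     of the term linear in the null measure. *)
  have := @jensen2_expR R alpha^-1 (alpha * ln (nullP i x) + (1 - alpha) * g)
     (g + alpha * l).
  rewrite invr_ge0 invf_le1 // (ltW a0) => /(_ isT a1).
  have -> : alpha^-1 * (alpha * ln (nullP i x) + (1 - alpha) * g) +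
     (1 - alpha^-1) * (g + alpha * l) = ln (nullP i x) + (alpha - 1) * l.
    by field; rewrite gt_eqF.
  rewrite -(ler_pM2l a0); set A := expR (alpha * _ + _); rewrite 2!expRD.
  rewrite lnK ?posrE ?nullP_gt0 // /geomean -/g => h.
  rewrite lerBlDr; apply: le_trans (le_trans h _).
    by apply: le_of_eq; ring.
  by apply: le_of_eq; field; rewrite gt_eqF.
apply: (@le_trans _ _ (\sum_x T y x * (alpha * expR ((alpha - 1) * l) * nullP i x -
    (alpha - 1) * expR (alpha * l) * geomean gamma x))); last first.
  by apply: ler_sum => x _; apply: ler_wpM2l.
rewrite (eq_bigr (fun x => alpha * expR ((alpha - 1) * l) * (T y x * nullP i x) -
    (alpha - 1) * expR (alpha * l) * (T y x * geomean gamma x)));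
  last by move=> x _; ring.
rewrite sumrB -!mulr_sumr.
(* The plane increases in the null measure and decreases in the geometric mean, matching the
   opposite directions of [TP] and [TQ]. *)
have c1 : 0 <= alpha * expR ((alpha - 1) * l).
  by rewrite mulr_ge0 ?expR_ge0 // ltW.
have c2 : 0 <= (alpha - 1) * expR (alpha * l).
  by rewrite mulr_ge0 ?expR_ge0 // subr_ge0.
apply: le_trans (lerB (ler_wpM2l c1 (TP i y)) (ler_wpM2l c2
  (geomean_le gd (T0 y) (fun j => altQ_gt0 j y) (fun j => TQ j y)))).
rewrite -/b -{2}(@lnK _ (nullP i y)) ?posrE ?nullP_gt0 //.
rewrite -!mulrA -!expRD.
(* Tangency at the processed pair: both terms become multiples of [expR (alpha * l + b)], with total
   coefficient [alpha - (alpha - 1) = 1]. *)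
have -> : (alpha - 1) * l + ln (nullP i y) = alpha * l + b by rewrite /l; ring.
rewrite -mulrBl (_ : alpha - (alpha - 1) = 1) ?mul1r; last by ring.
apply: le_of_eq.
by congr expR; rewrite /l; ring.
Qed.

(** The limit of [renyi_f alpha] to the power [1 / alpha] at order infinity; hence its exponent at
    [u] is 1 instead of [alpha]. *)
Definition renyi_max i gamma p : R :=
  \big[Num.max/0]_(x : carrier p) (nullP i x * \prod_j altQ j x `^ (- gamma j)).

Lemma renyi_maxE i gamma p : renyi_max i gamma p =
  \big[Num.max/0]_(x : carrier p) (nullP i x / geomean gamma x).
Proof.
apply: eq_bigr => x _; congr (_ * _).
rewrite -expRN -mulN1r -prod_powR_geomean.
by apply: eq_bigr => j _; rewrite mulN1r.
Qed.

Lemma renyi_max_ge i gamma p (x : carrier p) :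
  nullP i x / geomean gamma x <= renyi_max i gamma p.
Proof.
by rewrite renyi_maxE (le_bigmax (0 : R) (fun x => nullP i x / geomean gamma x) x).
Qed.

Lemma renyi_max_leP i gamma p M : 0 <= M ->
  (forall x : carrier p, nullP i x / geomean gamma x <= M) ->
  renyi_max i gamma p <= M.
Proof. by move=> M0 le; rewrite renyi_maxE; apply: bigmax_le. Qed.

Lemma renyi_max_ge0 i gamma p : 0 <= renyi_max i gamma p.
Proof. by rewrite renyi_maxE; exact: bigmax_ge_id. Qed.

Lemma renyi_max_gt0 i gamma p : (0 < #|carrier p|)%N -> 0 < renyi_max i gamma p.
Proof.
move=> /card_gt0P[x _]; apply: lt_le_trans (renyi_max_ge i gamma x).
by rewrite divr_gt0 ?nullP_gt0 ?expR_gt0.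
Qed.

Lemma geomean_tensor gamma p q (z : carrier p * carrier q) :
  @geomean gamma (fp_tensor p q) z = geomean gamma z.1 * geomean gamma z.2.
Proof.
rewrite /geomean -expRD -big_split /=; congr expR; apply: eq_bigr => j _.
by rewrite lnM ?posrE ?altQ_gt0 // mulrDr.
Qed.

Lemma renyi_max_tensor i gamma p q : renyi_max i gamma (fp_tensor p q) =
  renyi_max i gamma p * renyi_max i gamma q.
Proof.
have ratio_ge0 r (x : carrier r) : 0 <= nullP i x / geomean gamma x.
  by rewrite divr_ge0 ?expR_ge0 ?(ltW (nullP_gt0 _ _)).
apply/eqP; rewrite eq_le; apply/andP; split.
  apply: renyi_max_leP => [|z]; first by rewrite mulr_ge0 ?renyi_max_ge0.
  rewrite geomean_tensor invfM mulrACA.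
  by apply: ler_pM; rewrite ?ratio_ge0 ?renyi_max_ge.
(* The division below needs a positive maximum; on an empty carrier the default 0 settles the
   bound. *)
have [q0|q_gt0] := posnP #|carrier q|.
  have -> : renyi_max i gamma q = 0.
    rewrite renyi_maxE; apply/big_pred0 => x.
    by have := card0_eq q0 x; rewrite inE.
  by rewrite mulr0 renyi_max_ge0.
rewrite -ler_pdivlMr ?renyi_max_gt0 //; apply: renyi_max_leP => [|x].
  by rewrite divr_ge0 ?renyi_max_ge0.
rewrite ler_pdivlMr ?renyi_max_gt0 // mulrC.
rewrite -ler_pdivlMr ?divr_gt0 ?nullP_gt0 ?expR_gt0 //.
apply: renyi_max_leP => [|y]; first by rewrite divr_ge0 ?renyi_max_ge0.
rewrite ler_pdivlMr ?divr_gt0 ?nullP_gt0 ?expR_gt0 //.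
apply: le_trans (@renyi_max_ge i gamma (fp_tensor p q) (x, y)).
by rewrite geomean_tensor invfM [leRHS]mulrACA mulrC.
Qed.

Lemma renyi_max_one i gamma : renyi_max i gamma (fp_one R I J) = 1.
Proof.
rewrite renyi_maxE big_unit /geomean /= big1 => [|j _]; last by rewrite ln1 mulr0.
by rewrite expR0 divr1 max_l.
Qed.

Lemma renyi_max_u i gamma : renyi_max i gamma (fp_u R I J) = expR (1 * ln 2).
Proof.
rewrite renyi_maxE big_unit /geomean /= big1 => [|j _]; last by rewrite ln1 mulr0.
by rewrite expR0 divr1 max_l // mul1r lnK ?posrE.
Qed.

(** [renyi_max] is the least [M >= 0] with [nullP i <= M * geomean gamma] pointwise, and
    [geomean_le] carries this domination through a substochastic map. *)
Lemma renyi_max_le i gamma q p : is_distr gamma ->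
  fp_le q p -> renyi_max i gamma q <= renyi_max i gamma p.
Proof.
move=> gd [T [[T0 T1] TP TQ]]; apply: renyi_max_leP; first exact: renyi_max_ge0.
move=> y; rewrite ler_pdivrMr ?expR_gt0 //; apply: (le_trans (TP i y)).
apply: le_trans (ler_wpM2l (renyi_max_ge0 i gamma p)
  (geomean_le gd (T0 y) (fun j => altQ_gt0 j y) (fun j => TQ j y))).
rewrite mulr_sumr; apply: ler_sum => x _; rewrite mulrCA.
by apply: ler_wpM2l => //; rewrite -ler_pdivrMr ?expR_gt0 ?renyi_max_ge.
Qed.

(* An element of the asymptotic spectrum, restricted to nonempty carriers;
   [expR (c * ln 2)] is its value at [u]. *)
Record spectral_point (c : R) (f : fampair R I J -> R) : Prop := SpectralPoint {
  spectral_gt0 : forall p, (0 < #|carrier p|)%N -> 0 < f p;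
  spectral_one : f (fp_one R I J) = 1;
  spectral_u : f (fp_u R I J) = expR (c * ln 2);
  spectral_tensor : forall p q, f (fp_tensor p q) = f p * f q;
  spectral_le : forall q p, fp_le q p -> f q <= f p }.

Lemma renyi_f_spectral alpha i gamma : 1 <= alpha -> is_distr gamma ->
  spectral_point alpha (renyi_f alpha i gamma).
Proof.
move=> a1 gd; split.
- by move=> p; exact: renyi_f_gt0.
- exact: renyi_f_one.
- exact: renyi_f_u.
- exact: renyi_f_tensor.
- by move=> q p; exact: renyi_f_le.
Qed.

Lemma renyi_max_spectral i gamma : is_distr gamma ->
  spectral_point 1 (renyi_max i gamma).
Proof.
move=> gd; split.
- by move=> p; exact: renyi_max_gt0.
- exact: renyi_max_one.
- exact: renyi_max_u.
- exact: renyi_max_tensor.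
- by move=> q p; exact: renyi_max_le.
Qed.

End SpectralPoints.

Lemma ln2_gt0 {R : realType} : 0 < ln 2 :> R.
Proof. by rewrite ln_gt0 // ltr1n. Qed.

(** * Approximate additivity of logarithms along the sequence *)

Section ApproximateAdditivity.
Context {R : realType} {I J : finType}.
Implicit Types (p q : fampair R I J) (a : nat -> fampair R I J).

Lemma spectral_prod c f (s : seq (fampair R I J)) : spectral_point c f ->
  f (fp_prod s) = \prod_(p <- s) f p.
Proof.
move=> fs; elim: s => [|p s IH] /=; first by rewrite big_nil (spectral_one fs).
by rewrite big_cons (spectral_tensor fs) IH.
Qed.

Lemma spectral_upow c (f : fampair R I J -> R) k : spectral_point c f ->
  f (fp_upow R I J k) = expR (k%:R * (c * ln 2)).
Proof.
move=> fs; rewrite /fp_upow (spectral_prod _ fs) big_nseq (spectral_u fs).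
by rewrite iter_mulr_1 -expRM_natl.
Qed.

(** Keeps the sequence [k] visible, since all error bounds are expressed through it. *)
Definition geometric_with a (k : nat -> nat) : Prop :=
  forall s : seq nat, (0 < size s)%N ->
    let aprod := fp_prod [seq a n | n <- s] in
    let asum := a (\sum_(n <- s) n)%N in
    let ufac := fp_upow R I J (\sum_(n <- s) k n)%N in
    fp_le aprod (fp_tensor ufac asum) /\ fp_le asum (fp_tensor ufac aprod).

(** Apply [f] to both submajorizations: the power of [u] costs exactly [c] bits per unit of [k]. *)
Lemma spectral_additive c f a k (s : seq nat) : spectral_point c f ->
  (forall n, (0 < #|carrier (a n)|)%N) -> geometric_with a k -> (0 < size s)%N ->
  `|log2 (f (a (\sum_(n <- s) n)%N)) - \sum_(n <- s) log2 (f (a n))|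
    <= c * (\sum_(n <- s) k n)%:R.
Proof.
move=> fs a_gt0 geom s_gt0; have l2 := @ln2_gt0 R.
have f_gt0 n : 0 < f (a n) by apply: (spectral_gt0 fs).
have prod_gt0 : 0 < \prod_(n <- s) f (a n) by rewrite prodr_gt0.
have ln_prod : \sum_(n <- s) log2 (f (a n)) = log2 (\prod_(n <- s) f (a n)).
  rewrite /log2 -mulr_suml; congr (_ / _).
  elim: s {s_gt0 prod_gt0} => [|n s IH]; first by rewrite !big_nil ln1.
  by rewrite !big_cons lnM ?posrE ?prodr_gt0 // IH.
have [/(spectral_le fs) lo /(spectral_le fs) hi] := geom s s_gt0.
move: lo hi; rewrite !(spectral_tensor fs) !(spectral_upow _ fs) (spectral_prod _ fs) big_map.
have step x y z : 0 < x -> 0 < y -> x <= expR (z * (c * ln 2)) * y ->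
    log2 x <= c * z + log2 y.
  move=> x0 y0 h; have : ln x <= ln (expR (z * (c * ln 2)) * y).
    by rewrite ler_ln ?posrE ?mulr_gt0 ?expR_gt0.
  rewrite lnM ?posrE ?expR_gt0 // expRK => {}h.
  rewrite /log2 ler_pdivrMr // mulrDl divfK ?gt_eqF //.
  by rewrite (_ : c * z * ln 2 = z * (c * ln 2)) //; ring.
move=> /step lo /step hi; rewrite ln_prod ler_norml lerBlDr hi // andbT.
by rewrite lerBrDr addrC lerBlDl lo.
Qed.

(** Both rates are compared with the one at index [n * m], a sum of [m] copies of [n] and of [n]
    copies of [m]. *)
Lemma spectral_rate_cauchy c f a k n m : spectral_point c f ->
  (forall n, (0 < #|carrier (a n)|)%N) -> geometric_with a k -> (0 < n)%N -> (0 < m)%N ->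
  `|log2 (f (a n)) / n%:R - log2 (f (a m)) / m%:R|
    <= c * ((k n)%:R / n%:R) + c * ((k m)%:R / m%:R).
Proof.
move=> fs a_gt0 geom n0 m0; set L := fun n => log2 (f (a n)).
have block u v : (0 < u)%N -> (0 < v)%N ->
    `|L (u * v)%N / (u * v)%:R - L u / u%:R| <= c * ((k u)%:R / u%:R).
  move=> u0 v0; have := spectral_additive fs a_gt0 geom (s := nseq v u).
  rewrite size_nseq !big_nseq !iter_addn_0 iter_addr_0 -/(L _) => /(_ v0) h.
  have uv0 : 0 < (u * v)%:R :> R by rewrite ltr0n muln_gt0 u0.
  rewrite -(@ler_pM2r _ (u * v)%:R) // -[X in _ * X <= _](gtr0_norm uv0) -normrM.
  rewrite mulrBl divfK ?gt_eqF //.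
  have u_neq0 : u%:R != 0 :> R by rewrite pnatr_eq0 -lt0n.
  have -> : L u / u%:R * (u * v)%:R = L u *+ v by rewrite natrM mulr_natr; field.
  by apply: le_trans h _; rewrite !natrM; apply: le_of_eq; field.
have -> : L n / n%:R - L m / m%:R = - (L (n * m)%N / (n * m)%:R - L n / n%:R) +
   (L (n * m)%N / (n * m)%:R - L m / m%:R) by ring.
apply: le_trans (ler_normD _ _) _; rewrite normrN; apply: lerD; first exact: block.
by rewrite mulnC; exact: block.
Qed.

Lemma cvg_of_cauchy_rate (x e : nat -> R) :
  (forall n m, (0 < n)%N -> (0 < m)%N -> `|x n - x m| <= e n + e m) ->
  e @ \oo --> (0 : R) ->
  cvgn x /\ forall n, (0 < n)%N -> `|x n - limn x| <= e n.
Proof.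
move=> xe e0.
have x_cvg : cvgn x.
  apply/cauchy_cvgP/cauchyP => eps eps0.
  have eps2 : 0 < eps / 2 by rewrite divr_gt0.
  have [N _ HN] := (@cvgrPdist_lt _ _ _ _ _ _ _).1 e0 _ eps2.
  (* Indices start at [N.+1] because the hypothesis says nothing at index 0. *)
  exists (x N.+1); exists N.+1 => // n /= Nn.
  have small m : (N.+1 <= m)%N -> e m < eps / 2.
    move=> Nm; have := HN m (ltnW Nm); rewrite sub0r normrN.
    by apply: le_lt_trans; exact: ler_norm.
  rewrite /ball /=; apply: le_lt_trans (xe N.+1 n _ _) _ => //.
    by apply: leq_trans Nn.
  by rewrite (splitr eps); apply: ltrD; apply: small.
split=> // n n0; apply: (@ler_cvg_to _ \oo _ _ (fun m => `|x n - x m|) (fun m => e n + e m)).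
- by apply: cvg_norm; apply: cvgB; [exact: cvg_cst|].
- by rewrite -{2}(addr0 (e n)); apply: cvgD; [exact: cvg_cst|].
- by exists 1%N => // m /= m0; exact: xe.
Qed.

Lemma spectral_rate c f a k : spectral_point c f ->
  (forall n, (0 < #|carrier (a n)|)%N) -> geometric_with a k -> sublinear R k ->
  cvgn (fun n => log2 (f (a n)) / n%:R) /\
  forall n, (0 < n)%N ->
    `|log2 (f (a n)) / n%:R - limn (fun n => log2 (f (a n)) / n%:R)|
      <= c * ((k n)%:R / n%:R).
Proof.
move=> fs a_gt0 geom k0.
apply: (@cvg_of_cauchy_rate (fun n => log2 (f (a n)) / n%:R)
  (fun n => c * ((k n)%:R / n%:R))).
  by move=> n m n0 m0; exact: (spectral_rate_cauchy fs a_gt0 geom n0 m0).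
by rewrite -(mulr0 c); apply: cvgM; [exact: cvg_cst|].
Qed.

End ApproximateAdditivity.

(** * Existence, accuracy and monotonicity of the Renyi rates *)

Section RenyiRates.
Context {R : realType} {I J : finType}.
Implicit Types (p q : fampair R I J) (a : nat -> fampair R I J) (i : I) (gamma : J -> R).

Definition normalized p : Prop :=
  (forall i, is_distr (@nullP R I J p i)) /\ (forall j, is_distr (@altQ R I J p j)).

Lemma renyi_divE alpha i gamma p : 1 < alpha ->
  renyi_div alpha%:E i gamma p = (alpha - 1)^-1 * log2 (renyi_f alpha i gamma p).
Proof. by move=> a1 /=; rewrite gt_eqF. Qed.

Lemma renyi_rateE a alpha i gamma : 1 < alpha ->
  renyi_rate a alpha%:E i gamma = limn (renyi_seq a alpha%:E i gamma).
Proof. by move=> a1; rewrite /renyi_rate eqe gt_eqF. Qed.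

(** Summing all entries is a stochastic map from normalized families to the unit, so data processing
    applies. *)
Lemma renyi_f_ge1 alpha i gamma p : 1 <= alpha -> is_distr gamma ->
  normalized p -> 1 <= renyi_f alpha i gamma p.
Proof.
move=> a1 gd [Pd Qd]; rewrite -(renyi_f_one alpha i gamma).
apply: renyi_f_le => //; exists (fun _ _ => 1); split.
- by split=> // x; rewrite big_unit addr0.
- by move=> i' y; under eq_bigr do rewrite mul1r; rewrite (Pd i').2.
- by move=> j y; under eq_bigr do rewrite mul1r; rewrite (Qd j).2.
Qed.

Lemma renyi_div_ge0 alpha i gamma p : 1 < alpha -> is_distr gamma ->
  normalized p -> 0 <= renyi_div alpha%:E i gamma p.
Proof.
move=> a1 gd pd; rewrite renyi_divE // mulr_ge0 ?invr_ge0 ?subr_ge0 ?(ltW a1) //.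
by rewrite divr_ge0 ?(ltW ln2_gt0) // ln_ge0 // renyi_f_ge1 // ltW.
Qed.

(** Under [P_i], [renyi_f c] is the exponential moment of [(c - 1) * Y], with [Y] the log-likelihood
    ratio. The divergences are chord slopes from the origin of a convex cumulant function, which
    vanishes there by normalization. *)
Lemma renyi_div_mono alpha beta i gamma p : 1 < alpha -> alpha <= beta ->
  (0 < #|carrier p|)%N -> normalized p ->
  renyi_div alpha%:E i gamma p <= renyi_div beta%:E i gamma p.
Proof.
move=> a1 ab p_gt0 [Pd _]; have b1 := lt_le_trans a1 ab.
rewrite !renyi_divE // /log2 !mulrA ler_pM2r ?invr_gt0 ?ln2_gt0 //.
have a1' : 0 < alpha - 1 by rewrite subr_gt0.
have b1' : 0 < beta - 1 by rewrite subr_gt0.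
rewrite ler_pdivrMl //; set l := ln (renyi_f beta i gamma p).
set th := (alpha - 1) / (beta - 1).
have th0 : 0 <= th by rewrite divr_ge0 ?ltW.
have th1 : th <= 1 by rewrite ler_pdivrMr // mul1r lerD2r.
rewrite (_ : _ * _ = th * l); last by rewrite /th mulrA.
have fb_gt0 : 0 < renyi_f beta i gamma p by exact: renyi_f_gt0.
rewrite -[leRHS]expRK ler_ln ?posrE ?expR_gt0 ?renyi_f_gt0 //.
rewrite -[leRHS]mul1r -ler_pdivrMr ?expR_gt0 // renyi_fE mulr_suml.
set G := fun x : carrier p => \sum_j gamma j * ln (altQ j x).
set Y := fun x => ln (nullP i x) - G x.
have E c x : expR (c * ln (nullP i x) + (1 - c) * G x) = nullP i x * expR ((c - 1) * Y x).
  rewrite -{2}(@lnK _ (nullP i x)) ?posrE ?nullP_gt0 // -expRD.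
  by congr expR; rewrite /Y; ring.
apply: (@le_trans _ _ (\sum_x (th * (nullP i x * expR ((beta - 1) * Y x)) / expR l +
   (1 - th) * nullP i x))).
  apply: ler_sum => x _; rewrite -/(G x) E -(expRN (th * l)) -[leLHS]mulrA -expRD.
  have -> : (alpha - 1) * Y x + - (th * l) = th * ((beta - 1) * Y x - l) + (1 - th) * 0.
    by rewrite /th; field; rewrite gt_eqF.
  apply: (le_trans (ler_wpM2l (ltW (nullP_gt0 i x)) (jensen2_expR _ _ th0 th1))).
  by rewrite expR0 expRB; apply: le_of_eq; ring.
rewrite big_split /= -mulr_sumr (Pd i).2 -mulr_suml -mulr_sumr.
rewrite (_ : \sum_x _ = expR l) ?mulfK ?gt_eqF ?expR_gt0 //; first by lra.
by rewrite /l lnK ?posrE // renyi_fE; apply: eq_bigr => x _; rewrite -/(G x) E.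
Qed.

Lemma renyi_seqE a alpha i gamma : 1 < alpha -> renyi_seq a alpha%:E i gamma =
  fun n => (alpha - 1)^-1 * (log2 (renyi_f alpha i gamma (a n)) / n%:R).
Proof.
by move=> a1; apply/funext => n; rewrite /renyi_seq renyi_divE // mulrCA [n%:R^-1 * _]mulrC.
Qed.

Section Rates.
Variables (a : nat -> fampair R I J) (k : nat -> nat).
Hypothesis a_gt0 : forall n, (0 < #|carrier (a n)|)%N.
Hypothesis a_geom : geometric_with a k.
Hypothesis k_sublinear : sublinear R k.

Lemma renyi_seq_cvg alpha i gamma : 1 < alpha -> is_distr gamma ->
  cvgn (renyi_seq a alpha%:E i gamma).
Proof.
move=> a1 gd; rewrite renyi_seqE //.
have [h _] := spectral_rate (renyi_f_spectral i (ltW a1) gd) a_gt0 a_geom k_sublinear.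
by apply: is_cvgM; [exact: is_cvg_cst|].
Qed.

Lemma renyi_seq_pinfty_cvg i gamma : is_distr gamma ->
  cvgn (renyi_seq a +oo%E i gamma).
Proof.
move=> gd.
have [h _] := spectral_rate (renyi_max_spectral i gd) a_gt0 a_geom k_sublinear.
by apply: cvgP (_ : _ --> _); rewrite /renyi_seq /=; under eq_fun do rewrite mulrC; exact: h.
Qed.

Lemma renyi_rate_log_f alpha i gamma : 1 < alpha -> is_distr gamma ->
  renyi_rate a alpha%:E i gamma =
    (alpha - 1)^-1 * limn (fun n => log2 (renyi_f alpha i gamma (a n)) / n%:R).
Proof.
move=> a1 gd; rewrite renyi_rateE // renyi_seqE //.
have [h _] := spectral_rate (renyi_f_spectral i (ltW a1) gd) a_gt0 a_geom k_sublinear.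
by apply/cvg_lim => //; apply: cvgM; [exact: cvg_cst|].
Qed.

(** The logarithm of [renyi_f] is accurate up to [alpha * k n], and the divergence divides it by
    [alpha - 1]. The bound is uniform in [gamma]. *)
Lemma renyi_rate_dist alpha i gamma n : 1 < alpha -> is_distr gamma -> (0 < n)%N ->
  `|renyi_div alpha%:E i gamma (a n) / n%:R - renyi_rate a alpha%:E i gamma|
    <= alpha / (alpha - 1) * ((k n)%:R / n%:R).
Proof.
move=> a1 gd n0; rewrite renyi_rate_log_f // renyi_divE //.
have [_ /(_ n n0) h] :=
  spectral_rate (renyi_f_spectral i (ltW a1) gd) a_gt0 a_geom k_sublinear.
have a1' : 0 < (alpha - 1)^-1 by rewrite invr_gt0 subr_gt0.
rewrite -[X in `|X - _|]mulrA -mulrBr normrM gtr0_norm //.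
by apply: le_trans (ler_wpM2l (ltW a1') h) _; apply: le_of_eq; ring.
Qed.

Lemma renyi_f_root_cvg alpha i gamma : 1 < alpha -> is_distr gamma ->
  renyi_f_root a alpha i gamma @ \oo -->
    expR (limn (fun n => log2 (renyi_f alpha i gamma (a n)) / n%:R) * ln 2).
Proof.
move=> a1 gd.
have [h _] := spectral_rate (renyi_f_spectral i (ltW a1) gd) a_gt0 a_geom k_sublinear.
have -> : renyi_f_root a alpha i gamma =
    (fun n => expR (log2 (renyi_f alpha i gamma (a n)) / n%:R * ln 2)).
  apply/funext => n; rewrite /renyi_f_root /powR gt_eqF ?renyi_f_gt0 //.
  by congr expR; rewrite /log2 mulrAC divfK ?gt_eqF ?ln2_gt0 // mulrC.
apply: continuous_cvg; first exact: continuous_expR.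
by apply: cvgM; [exact: h|exact: cvg_cst].
Qed.

Lemma renyi_f_rate_log alpha i gamma : 1 < alpha -> is_distr gamma ->
  renyi_rate a alpha%:E i gamma = (alpha - 1)^-1 * log2 (renyi_f_rate a alpha i gamma).
Proof.
move=> a1 gd; rewrite renyi_rate_log_f //; congr (_ * _).
rewrite /renyi_f_rate (cvg_lim _ (renyi_f_root_cvg a1 gd)) //.
by rewrite /log2 expRK mulfK // gt_eqF // ln2_gt0.
Qed.

Hypothesis a_distr : forall n, normalized (a n).

Lemma renyi_rate_ge0 alpha i gamma : 1 < alpha -> is_distr gamma ->
  0 <= renyi_rate a alpha%:E i gamma.
Proof.
move=> a1 gd; rewrite renyi_rateE //; apply: limr_ge; first exact: renyi_seq_cvg.
by apply: nearW => n; rewrite /renyi_seq mulr_ge0 ?invr_ge0 ?renyi_div_ge0.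
Qed.

Lemma renyi_rate_mono alpha beta i gamma : 1 < alpha -> alpha <= beta ->
  is_distr gamma -> renyi_rate a alpha%:E i gamma <= renyi_rate a beta%:E i gamma.
Proof.
move=> a1 ab gd; have b1 := lt_le_trans a1 ab; rewrite !renyi_rateE //.
apply: ler_lim; [exact: renyi_seq_cvg|exact: renyi_seq_cvg|].
by apply: nearW => n; rewrite /renyi_seq ler_wpM2l ?invr_ge0 ?renyi_div_mono.
Qed.

(** The rates are nondecreasing in the order and bounded below by 0. *)
Lemma renyi_rate_cvg_at1 i gamma : is_distr gamma ->
  cvg (renyi_rate a b%:E i gamma @[b --> (1 : R)^'+]).
Proof.
move=> gd; apply: nondecreasing_at_right_is_cvgr.
  apply: nearW => x u v; rewrite !in_itv /= => /andP[u1 ux] /andP[v1 vx] uv.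
  exact: renyi_rate_mono.
apply: nearW => x; exists 0; move=> y /= [u]; rewrite in_itv /= => /andP[u1 ux] <-.
exact: renyi_rate_ge0.
Qed.

End Rates.
End RenyiRates.

Lemma cvg_sumr {R : realType} {T : Type} {F : set_system T} {FF : Filter F}
    {X : finType} (f : X -> T -> R) (l : X -> R) :
  (forall x, f x t @[t --> F] --> l x) ->
  \sum_x f x t @[t --> F] --> \sum_x l x.
Proof.
by move=> fl; apply: cvg_big => [|x _]; [exact: add_continuous|exact: fl].
Qed.

(** * Compactness of the simplex and attained maxima *)

Section CompactSimplex.
Import ArrowAsProduct.
Context {R : realType} {J : finType}.
Implicit Types (theta : J -> R) (c : R).

Definition subsimplex c : set (J -> R) :=
  [set theta | (forall j, 0 <= theta j) /\ \sum_j theta j <= c].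

Lemma continuous_coord (j : J) : continuous (fun theta : J -> R => theta j).
Proof. exact: (@proj_continuous J (fun=> R) j). Qed.

Lemma continuous_coord_sum : continuous (fun theta : J -> R => \sum_j theta j).
Proof.
move=> theta; apply: (@cvg_sumr R (J -> R) (nbhs theta) _ J (fun j eta => eta j) theta) => j.
exact: (@continuous_coord j theta).
Qed.

Lemma compact_box c : compact [set theta : J -> R | forall j, `[0, c]%classic (theta j)].
Proof.
exact: (@tychonoff J (fun=> R) (fun=> `[0, c]%classic) (fun=> @segment_compact R 0 c)).
Qed.

Lemma compact_subsimplex c : compact (subsimplex c).
Proof.
have -> : subsimplex c = [set theta : J -> R | forall j, `[0, c]%classic (theta j)]
    `&` [set theta | \sum_j theta j <= c].
  apply/seteqP; split=> theta [] /=; last first.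
    by move=> box le; split=> // j; have := box j; rewrite in_itv /= => /andP[].
  move=> t0 tc; split=> // j; rewrite in_itv /= t0 /=.
  by apply: le_trans tc; rewrite (bigD1 j) //= lerDl sumr_ge0.
apply: compact_closedI; first exact: compact_box.
exact: (@closed_comp _ _ (fun theta : J -> R => \sum_j theta j) [set y | y <= c]
  (fun theta _ => @continuous_coord_sum theta) (@closed_le R c)).
Qed.

Lemma compact_simplex : compact [set theta : J -> R | is_distr theta].
Proof.
have -> : [set theta : J -> R | is_distr theta] =
    subsimplex 1 `&` [set theta | \sum_j theta j = 1].
  apply/seteqP; split=> theta /=; first by case=> t0 t1; split=> //; split=> //; rewrite t1.
  by case=> -[].
apply: compact_closedI; first exact: compact_subsimplex.
exact: (@closed_comp _ _ (fun theta : J -> R => \sum_j theta j) [set y | y = 1]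
  (fun theta _ => @continuous_coord_sum theta) (@closed_eq R 1)).
Qed.

(* [g] is continuous on the simplex, being a uniform limit of continuous
   functions there. *)
Lemma simplex_max (g : (J -> R) -> R) : (0 < #|J|)%N ->
  (forall e, 0 < e -> exists2 phi : (J -> R) -> R, continuous phi &
     forall gamma, is_distr gamma -> `|g gamma - phi gamma| <= e) ->
  exists2 gamma, is_distr gamma & forall gamma', is_distr gamma' -> g gamma' <= g gamma.
Proof.
move=> /card_gt0P[j0 _] approx.
have g_cont : {within [set theta : J -> R | is_distr theta], continuous g}.
  apply/subspace_continuousP => gamma gd; apply/cvgrPdist_le => e e0.
  have e3 : 0 < e / 3 by rewrite divr_gt0.
  have [phi phi_cont close] := approx _ e3.
  have /cvgrPdist_le/(_ _ e3) : phi x @[x --> within [set theta | is_distr theta] (nbhs gamma)]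
      --> phi gamma by apply: cvg_within_filter; exact: phi_cont.
  apply: filterS2 (withinT _ (nbhs_filter gamma)) => eta /= ed phi_close.
  have -> : g gamma - g eta =
    (g gamma - phi gamma) + (phi gamma - phi eta) - (g eta - phi eta) by ring.
  rewrite (_ : e = e / 3 + e / 3 + e / 3); last by field.
  apply: le_trans (ler_normB _ _) _; apply: lerD; last exact: close.
  by apply: le_trans (ler_normD _ _) _; apply: lerD; first exact: close.
have ne : [set theta : J -> R | is_distr theta] !=set0.
  exists (fun j => (j == j0)%:R); split=> [j|]; first exact: ler0n.
  by rewrite (bigD1 j0) //= eqxx big1 ?addr0 // => j /negbTE ->.
have [gamma] := compact_EVT_max ne compact_simplex g_cont.
rewrite inE => gd gmax; exists gamma => // gamma' gd'.
by apply: gmax; rewrite inE.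
Qed.

Lemma subsimplex_max c (h : (J -> R) -> R) : 0 <= c ->
  (forall theta, subsimplex c theta -> {for theta, continuous h}) ->
  exists2 theta, subsimplex c theta & forall eta, subsimplex c eta -> h eta <= h theta.
Proof.
move=> c0 h_cont.
have ne : subsimplex c !=set0 by exists (fun=> 0); split=> //; rewrite big1.
have h_within : {within subsimplex c, continuous h}.
  by apply: continuous_in_subspaceT => theta; rewrite inE; exact: h_cont.
have [theta] := compact_EVT_max ne (@compact_subsimplex c) h_within.
rewrite inE => td tmax; exists theta => // eta ed.
by apply: tmax; rewrite inE.
Qed.

End CompactSimplex.

(** * Lagrange duality for relative entropies *)

Section SaddlePoint.
Context {R : realType} {X J : finType}.
Variables (x0 : X) (A : X -> R) (B : J -> X -> R) (r : R).
Implicit Types (theta eta : J -> R) (lambda : X -> R).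

(** With [A = ln P] and [B j = ln Q_j], the stationarity condition of the Lagrangian in [lambda]
    gives this exponent, up to normalization. *)
Definition log_tilt theta x : R :=
  (A x - \sum_j theta j * B j x) / (1 - \sum_j theta j).

Definition tilt_mass theta : R := \sum_x expR (log_tilt theta x).

Definition tilt theta x : R := expR (log_tilt theta x - ln (tilt_mass theta)).

Definition dual_value theta : R :=
  (\sum_j theta j) * r - (1 - \sum_j theta j) * ln (tilt_mass theta).

(** The relative entropy to the null is the objective; the constraints ask for relative entropies of
    at least [r] to the alternatives. *)
Definition lagrangian lambda theta : R :=
  \sum_x lambda x * (ln (lambda x) - A x) +
  \sum_j theta j * (r - \sum_x lambda x * (ln (lambda x) - B j x)).

Lemma tilt_mass_gt0 theta : 0 < tilt_mass theta.
Proof.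
rewrite /tilt_mass (bigD1 x0) //= ltr_wpDr ?expR_gt0 //.
by apply: sumr_ge0 => x _; exact: expR_ge0.
Qed.

Lemma tilt_distr theta : is_distr (tilt theta).
Proof.
split=> [x|]; first exact: expR_ge0.
under eq_bigr do rewrite /tilt expRB lnK ?posrE ?tilt_mass_gt0 //.
by rewrite -mulr_suml mulfV // gt_eqF // tilt_mass_gt0.
Qed.

(** Gibbs variational principle: collecting the terms in [lambda] completes them to a multiple of
    the relative entropy to the tilt, nonnegative and zero at the tilt. *)
Lemma lagrangianE lambda theta : is_distr lambda -> \sum_j theta j < 1 ->
  lagrangian lambda theta = dual_value theta +
    (1 - \sum_j theta j) * \sum_x lambda x * (ln (lambda x) - ln (tilt theta x)).
Proof.
move=> [l0 l1] t1; rewrite /lagrangian /dual_value; set s := \sum_j theta j.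
have s_neq0 : 1 - s != 0 by rewrite gt_eqF // subr_gt0.
set H := \sum_x lambda x * ln (lambda x).
set EA := \sum_x lambda x * A x.
set EB := fun j => \sum_x lambda x * B j x.
have -> : \sum_x lambda x * (ln (lambda x) - A x) = H - EA.
  by rewrite /H /EA -sumrB; apply: eq_bigr => x _; rewrite mulrBr.
have -> : \sum_j theta j * (r - \sum_x lambda x * (ln (lambda x) - B j x)) =
    s * (r - H) + \sum_j theta j * EB j.
  rewrite /s mulr_suml -big_split /=; apply: eq_bigr => j _.
  rewrite -mulrDr; congr (_ * _); rewrite -addrA; congr (_ + _).
  by rewrite /H /EB -!sumrN -big_split /=; apply: eq_bigr => x _; ring.
have -> : \sum_x lambda x * (ln (lambda x) - ln (tilt theta x)) =
    H - (EA - \sum_j theta j * EB j) / (1 - s) + ln (tilt_mass theta).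
  have -> : \sum_j theta j * EB j = \sum_x lambda x * \sum_j theta j * B j x.
    under eq_bigr do rewrite mulr_sumr; rewrite exchange_big /=.
    by apply: eq_bigr => x _; rewrite mulr_sumr; apply: eq_bigr => j _; ring.
  rewrite -[X in _ = _ + X]mul1r -[X in _ = _ + X * _]l1 [X in _ = _ + X]mulr_suml.
  rewrite /H /EA -!sumrB mulr_suml -sumrB -big_split /=.
  by apply: eq_bigr => x _; rewrite /tilt expRK /log_tilt -/s; field.
by field.
Qed.

Lemma lagrangian_ge lambda theta : is_distr lambda -> (forall x, 0 < lambda x) ->
  \sum_j theta j < 1 -> dual_value theta <= lagrangian lambda theta.
Proof.
move=> ld l0 t1; rewrite lagrangianE // lerDl mulr_ge0 ?subr_ge0 ?(ltW t1) //.
by apply: gibbs => //; [move=> x; exact: expR_gt0|rewrite (tilt_distr theta).2].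
Qed.

Lemma lagrangian_tilt theta : \sum_j theta j < 1 ->
  lagrangian (tilt theta) theta = dual_value theta.
Proof.
move=> t1; rewrite lagrangianE //; last exact: tilt_distr.
by rewrite [X in _ * X]big1 ?mulr0 ?addr0 // => x _; rewrite subrr mulr0.
Qed.

Section Continuity.
Context {T : Type} {F : set_system T} {FF : Filter F}.
Variables (u : T -> J -> R) (theta : J -> R).
Hypothesis u_cvg : forall j, u t j @[t --> F] --> theta j.
Hypothesis theta_lt1 : \sum_j theta j < 1.

(** The filter is arbitrary: it serves for neighbourhoods in the product topology and for the
    approach along a segment. *)
Lemma log_tilt_cvg x : log_tilt (u t) x @[t --> F] --> log_tilt theta x.
Proof.
apply: cvgM.
  apply: cvgB; first exact: cvg_cst.
  by apply: cvg_sumr => j; apply: cvgM; [exact: u_cvg|exact: cvg_cst].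
apply: cvgV; first by rewrite gt_eqF // subr_gt0.
by apply: cvgB; [exact: cvg_cst|apply: cvg_sumr; exact: u_cvg].
Qed.

Lemma ln_tilt_mass_cvg : ln (tilt_mass (u t)) @[t --> F] --> ln (tilt_mass theta).
Proof.
apply: continuous_cvg; first by apply: continuous_ln; exact: tilt_mass_gt0.
apply: cvg_sumr => x; apply: continuous_cvg; first exact: continuous_expR.
exact: log_tilt_cvg.
Qed.

Lemma dual_value_cvg : dual_value (u t) @[t --> F] --> dual_value theta.
Proof.
have s_cvg : \sum_j u t j @[t --> F] --> \sum_j theta j by apply: cvg_sumr.
apply: cvgB; first by apply: cvgM; [exact: s_cvg|exact: cvg_cst].
apply: cvgM; last exact: ln_tilt_mass_cvg.
by apply: cvgB; [exact: cvg_cst|exact: s_cvg].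
Qed.

Lemma lagrangian_cvg eta :
  lagrangian (tilt (u t)) eta @[t --> F] --> lagrangian (tilt theta) eta.
Proof.
have ln_cvg x : log_tilt (u t) x - ln (tilt_mass (u t)) @[t --> F] -->
    log_tilt theta x - ln (tilt_mass theta).
  by apply: cvgB; [exact: log_tilt_cvg|exact: ln_tilt_mass_cvg].
have rel_cvg (C : X -> R) : \sum_x tilt (u t) x * (ln (tilt (u t) x) - C x) @[t --> F] -->
    \sum_x tilt theta x * (ln (tilt theta x) - C x).
  apply: cvg_sumr => x; apply: cvgM.
    by apply: continuous_cvg; [exact: continuous_expR|exact: ln_cvg].
  rewrite /tilt expRK; under eq_fun do rewrite expRK.
  by apply: cvgB; [exact: ln_cvg|exact: cvg_cst].
apply: cvgD; first exact: rel_cvg.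
apply: cvg_sumr => j; apply: cvgM; first exact: cvg_cst.
by apply: cvgB; [exact: cvg_cst|exact: rel_cvg].
Qed.

End Continuity.

Section ProductTopology.
Import ArrowAsProduct.

Lemma dual_value_continuous theta : \sum_j theta j < 1 ->
  {for theta, continuous dual_value}.
Proof.
move=> t1; apply: (@dual_value_cvg (J -> R) (nbhs theta) _ (fun eta => eta)) => // j.
exact: (@continuous_coord R J j theta).
Qed.

End ProductTopology.

(* The Lagrangian is affine in [theta], and the tilted distribution minimises it
   over the primal variable. Comparing a maximiser [theta] of the dual value with
   the points of the segment towards [eta], and letting these tend to [theta],
   shows that the tilt at [theta] is a saddle point. *)
Lemma saddle_point c M : 0 <= c -> c < 1 ->
  (forall theta, subsimplex c theta -> dual_value theta <= M) ->
  exists lambda, [/\ is_distr lambda, forall x, 0 < lambda x &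
    forall eta, subsimplex c eta -> lagrangian lambda eta <= M].
Proof.
move=> c0 c1 dualM.
have lt1 theta : subsimplex c theta -> \sum_j theta j < 1.
  by move=> [_ tc]; exact: le_lt_trans c1.
have [theta td tmax] : exists2 theta, subsimplex c theta &
    forall eta, subsimplex c eta -> dual_value eta <= dual_value theta.
  exact: (@subsimplex_max R J c dual_value c0
    (fun theta td => dual_value_continuous (lt1 theta td))).
exists (tilt theta); split; [exact: tilt_distr|by move=> x; exact: expR_gt0|].
move=> eta ed; apply: le_trans (dualM _ td).
pose u (s : R) j := (1 - s) * theta j + s * eta j.
have u_in s : 0 < s -> s < 1 -> subsimplex c (u s).
  move=> s0 s1; have [t0 tc] := td; have [e0 ec] := ed; split=> [j|].
    by rewrite addr_ge0 // mulr_ge0 // ?subr_ge0 // ltW.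
  rewrite big_split /= -!mulr_sumr.
  have -> : c = (1 - s) * c + s * c by ring.
  by apply: lerD; apply: ler_wpM2l => //; rewrite ?subr_ge0 ltW.
have u_cvg j : u s j @[s --> (0 : R)^'+] --> theta j.
  have : u s j @[s --> (0 : R)] --> (1 - 0) * theta j + 0 * eta j.
    apply: cvgD; apply: cvgM; try exact: cvg_cst; last exact: cvg_id.
    by apply: cvgB; [exact: cvg_cst|exact: cvg_id].
  rewrite subr0 mul1r mul0r addr0; exact: cvg_at_right_filter.
have lim := @lagrangian_cvg R _ _ u theta u_cvg (lt1 _ td) eta.
apply: (ler_cvg_to (lim _) (cvg_cst (dual_value theta))).
near=> s.
have s0 : 0 < s by [].
have s1 : s < 1 by near: s; exact: nbhs_right_lt.
have ud := u_in s s0 s1.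
have := tmax _ ud; rewrite -(lagrangian_tilt (lt1 _ ud)).
have -> : lagrangian (tilt (u s)) (u s) =
  (1 - s) * lagrangian (tilt (u s)) theta + s * lagrangian (tilt (u s)) eta.
  rewrite /lagrangian; move: (\sum_x _ * (_ - A x)) => K; rewrite !mulrDr !mulr_sumr.
  rewrite [RHS]addrACA -mulrDl subrK mul1r -big_split /=; congr (_ + _).
  by apply: eq_bigr => j _; rewrite /u; ring.
(* The [theta] part of the combination is at least [dual_value theta] and the whole is at most that,
   so the [eta] part is too, after division by [s]. *)
have := lagrangian_ge (tilt_distr (u s)) (fun x => expR_gt0 _) (lt1 _ td).
rewrite -(ler_pM2l (_ : 0 < 1 - s)) ?subr_gt0 // => lo hi.
by rewrite -(ler_pM2l s0); lra.
Unshelve. all: by end_near. Qed.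

End SaddlePoint.

(** * From Renyi bounds on a block to a sampling distribution *)

Section BlockDistribution.
Context {R : realType} {I J : finType}.
Implicit Types (p : fampair R I J) (i : I) (gamma theta : J -> R).

(** Here [1 - sum theta = 1 / alpha], so the tilt mass is [renyi_f alpha]; [ln 2] converts bits to
    nats. *)
Lemma dual_value_renyi i gamma p (alpha r : R) (theta : J -> R) : 1 < alpha ->
  is_distr gamma -> theta =1 (fun j => (alpha - 1) / alpha * gamma j) ->
  dual_value (fun x : carrier p => ln (nullP i x)) (fun j x => ln (altQ j x)) r theta =
    (alpha - 1) / alpha * (r - ln 2 * renyi_div alpha%:E i gamma p).
Proof.
move=> a1 [g0 g1] thetaE; have a0 : 0 < alpha by exact: lt_trans a1.
have s_theta : \sum_j theta j = (alpha - 1) / alpha.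
  by under eq_bigr do rewrite thetaE; rewrite -mulr_sumr g1 mulr1.
rewrite /dual_value; have -> : tilt_mass (fun x : carrier p => ln (nullP i x))
    (fun j x => ln (altQ j x)) theta = renyi_f alpha i gamma p.
  rewrite renyi_fE; apply: eq_bigr => x _; congr expR.
  rewrite /log_tilt s_theta.
  have -> : \sum_j theta j * ln (altQ j x) =
      (alpha - 1) / alpha * \sum_j gamma j * ln (altQ j x).
    by rewrite mulr_sumr; apply: eq_bigr => j _; rewrite thetaE mulrA.
  by field; rewrite opprB addrC subrK oner_eq0 gt_eqF.
rewrite renyi_divE // /log2 s_theta; have l2 := @ln2_gt0 R.
by field; rewrite !gt_eqF // subr_gt0.
Qed.

Lemma block_distribution i p (r c M : R) : (0 < #|carrier p|)%N -> normalized p ->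
  0 < c -> c < 1 -> 0 <= M ->
  (forall alpha gamma, 1 < alpha -> is_distr gamma ->
    (alpha - 1) / alpha * (r - ln 2 * renyi_div alpha%:E i gamma p) <= M) ->
  exists lambda : carrier p -> R, [/\ is_distr lambda, forall x, 0 < lambda x,
    \sum_x lambda x * (ln (lambda x) - ln (nullP i x)) <= M / c &
    forall j, r + \sum_x lambda x * (ln (altQ j x) - ln (nullP i x)) <= M / c].
Proof.
move=> /card_gt0P[x0 _] [Pd Qd] c0 c1 M0 renyiM.
have dualM theta : subsimplex c theta ->
    dual_value (fun x : carrier p => ln (nullP i x)) (fun j x => ln (altQ j x)) r theta <= M.
  move=> [t0 tc]; set s := \sum_j theta j in tc.
  have s0 : 0 <= s by exact: sumr_ge0.
  (* Mass 0 corresponds to order 1, outside the hypothesis: the tilt is then [P_i] itself, of mass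
     1, and the dual value is 0. *)
  have [s_eq0|s_neq0] := eqVneq s 0.
    have theta0 j : theta j = 0 by exact: (psumr_eq0P (fun j _ => t0 j) s_eq0).
    rewrite /dual_value -/s s_eq0 mul0r sub0r subr0 mul1r.
    rewrite (_ : tilt_mass _ _ _ = 1) ?ln1 ?oppr0 //.
    rewrite -(Pd i).2; apply: eq_bigr => x _.
    rewrite /log_tilt -/s s_eq0 subr0 divr1 big1 => [|j _]; last by rewrite theta0 mul0r.
    by rewrite subr0 lnK // posrE nullP_gt0.
  have s_gt0 : 0 < s by rewrite lt_def s_neq0.
  have s1 : 0 < 1 - s by rewrite subr_gt0; exact: le_lt_trans c1.
  have a1 : 1 < (1 - s)^-1 by rewrite invf_gt1 // gtrBl.
  have gd : is_distr (fun j => theta j / s).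
    by split=> [j|]; [rewrite divr_ge0|rewrite -mulr_suml mulfV].
  rewrite (dual_value_renyi i p r a1 gd) ?renyiM // => j.
  by field; rewrite s_neq0 gt_eqF.
have [lambda [ld l0 lagM]] := saddle_point x0 (ltW c0) c1 dualM.
set D := \sum_x lambda x * (ln (lambda x) - ln (nullP i x)).
have D0 : 0 <= D by apply: gibbs => //; [exact: nullP_gt0|rewrite (Pd i).2].
have DM : D <= M.
  have := lagM (fun=> 0); rewrite /lagrangian [X in _ + X]big1 ?addr0 => [|j _].
    by apply; split=> //; rewrite big1 // ltW.
  by rewrite mul0r.
exists lambda; split=> //.
  by apply: le_trans DM _; rewrite ler_pdivlMr // ler_piMr // ltW.
move=> j; rewrite ler_pdivlMr //.
have := lagM (fun j' => if j' == j then c else 0); rewrite /lagrangian -/D.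
rewrite (bigD1 j) //= eqxx [X in _ + (_ + X)]big1 ?addr0 => [|j' /negbTE ->];
  last by rewrite mul0r.
have sub : subsimplex c (fun j' => if j' == j then c else 0).
  split=> [j'|]; first by case: ifP => // _; rewrite ltW.
  by rewrite (bigD1 j) //= eqxx big1 ?addr0 // => j' /negbTE ->.
move=> /(_ sub); set E := \sum_x _ => h.
have -> : \sum_x lambda x * (ln (altQ j x) - ln (nullP i x)) = D - E.
  by rewrite /D /E -sumrB; apply: eq_bigr => x _; ring.
(* Since [c * D <= D], the bound [D + c * (r - E) <= M] yields [c * (r + D - E) <= M]; this is the
   origin of [M / c]. *)
have : 0 <= (1 - c) * D by rewrite mulr_ge0 // subr_ge0 ltW.
lra.
Qed.

End BlockDistribution.

(** * Means and variances under product distributions *)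

Section ProductMoments.
Context {R : realType} {X Y : finType}.
Variables (w : X -> R) (v : Y -> R).

Lemma sum_prod_weight (F : X -> R) (G : Y -> R) :
  \sum_(z : X * Y) w z.1 * v z.2 * (F z.1 * G z.2) =
    (\sum_x w x * F x) * \sum_y v y * G y.
Proof.
rewrite big_distrlr /= pair_bigA /=; apply: eq_bigr => z _; exact: mulrACA.
Qed.

Lemma prod_distr : is_distr w -> is_distr v -> is_distr (fun z : X * Y => w z.1 * v z.2).
Proof.
move=> [w0 w1] [v0 v1]; split=> [z|]; first by rewrite mulr_ge0.
by rewrite -(pair_bigA _ (fun x y => w x * v y)) /= -big_distrlr /= w1 v1 mulr1.
Qed.

(** By independence the cross term of the square is a product of two vanishing means. *)
Lemma prod_centered (F : X -> R) (G : Y -> R) : is_distr w -> is_distr v ->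
  \sum_x w x * F x = 0 -> \sum_y v y * G y = 0 ->
  \sum_(z : X * Y) w z.1 * v z.2 * (F z.1 + G z.2) = 0 /\
  \sum_(z : X * Y) w z.1 * v z.2 * (F z.1 + G z.2) ^+ 2 =
    \sum_x w x * F x ^+ 2 + \sum_y v y * G y ^+ 2.
Proof.
move=> [_ w1] [_ v1] F0 G0; split.
  rewrite (eq_bigr (fun z => w z.1 * v z.2 * (F z.1 * 1) + w z.1 * v z.2 * (1 * G z.2)));
    last by move=> z _; ring.
  rewrite big_split /= !(sum_prod_weight F (fun=> 1)) !(sum_prod_weight (fun=> 1) G).
  by rewrite F0 G0 mul0r mulr0 addr0.
rewrite (eq_bigr (fun z => w z.1 * v z.2 * (F z.1 ^+ 2 * 1) +
    w z.1 * v z.2 * (2 * F z.1 * G z.2) + w z.1 * v z.2 * (1 * G z.2 ^+ 2)));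
  last by move=> z _; ring.
rewrite !big_split /= (sum_prod_weight (fun x => F x ^+ 2) (fun=> 1)).
rewrite (sum_prod_weight (fun=> 1) (fun y => G y ^+ 2)).
rewrite (sum_prod_weight (fun x => 2 * F x) G) G0 mulr0 addr0.
rewrite -[\sum_x w x * 1]mulr_suml -[\sum_y v y * 1]mulr_suml w1 v1.
by rewrite !mulr1 mul1r.
Qed.

End ProductMoments.

(** * Tests on powers of a block for one null measure *)

Section IidTest.
Context {R : realType} {I J : finType}.
Implicit Types (p q : fampair R I J) (i : I) (k : option J).

(** [None] stands for the sampling distribution, so that one argument treats it together with the
    alternatives. *)
Definition log_ratio i p (lambda : carrier p -> R) k (x : carrier p) : R :=
  ln (nullP i x) - (if k is Some j then ln (altQ j x) else ln (lambda x)).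

Lemma iid_moments i p (lambda : carrier p -> R) (mu v : option J -> R) :
  is_distr lambda -> (forall x, 0 < lambda x) ->
  (forall k, mu k = \sum_x lambda x * log_ratio i lambda k x) ->
  (forall k, v k = \sum_x lambda x * (log_ratio i lambda k x - mu k) ^+ 2) ->
  forall t, exists Lambda : carrier (fp_prod (nseq t p)) -> R,
    [/\ is_distr Lambda, forall y, 0 < Lambda y,
      forall k, \sum_y Lambda y * (log_ratio i Lambda k y - t%:R * mu k) = 0 &
      forall k, \sum_y Lambda y * (log_ratio i Lambda k y - t%:R * mu k) ^+ 2 = t%:R * v k].
Proof.
move=> ld l0 muE vE; elim=> [|t [L [Ld L0 LE LV]]].
  have ratio0 k : @log_ratio i (fp_one R I J) (fun=> 1) k tt = 0.
    by rewrite /log_ratio /=; case: k => [j|]; rewrite subrr.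
  exists (fun=> 1); split=> //.
  - by split=> //; rewrite big_unit addr0.
  - by move=> k; rewrite big_unit ratio0 mul0r subrr mulr0 addr0.
  - by move=> k; rewrite big_unit ratio0 !mul0r subrr expr0n mulr0 addr0.
pose L' (z : carrier p * carrier (fp_prod (nseq t p))) := lambda z.1 * L z.2.
have ratioE k z : @log_ratio i (fp_prod (nseq t.+1 p)) L' k z - t.+1%:R * mu k =
    (log_ratio i lambda k z.1 - mu k) + (log_ratio i L k z.2 - t%:R * mu k).
  rewrite -natr1 mulrDl mul1r /log_ratio /= lnM ?posrE ?nullP_gt0 //.
  case: k => [j|]; first by rewrite lnM ?posrE ?altQ_gt0 //; ring.
  by rewrite /L' lnM ?posrE //; ring.
have lE k : \sum_x lambda x * (log_ratio i lambda k x - mu k) = 0.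
  under eq_bigr do rewrite mulrBr.
  by rewrite sumrB -mulr_suml ld.2 mul1r -muE subrr.
have moments k := prod_centered ld Ld (lE k) (LE k).
exists L'; split=> [||k|k].
- exact: prod_distr.
- by move=> z; rewrite mulr_gt0.
- by under eq_bigr do rewrite ratioE; exact: (moments k).1.
- under eq_bigr do rewrite ratioE.
  by rewrite (moments k).2 -vE LV -natr1 mulrDl mul1r addrC.
Qed.

(* With [Y_k] the log-likelihood ratios of the null measure to the product
   [Lambda] and to the alternatives, the test is [Lambda / P] damped by a penalty
   that dominates all deviations of the [Y_k] from their means. The variances
   being additive, the expected penalty grows linearly in [t], with a slope that
   the scale [c] makes arbitrarily small. *)
Lemma iid_test i p (lambda : carrier p -> R) (r B delta : R) : 0 < delta ->
  is_distr lambda -> (forall x, 0 < lambda x) ->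
  \sum_x lambda x * (ln (lambda x) - ln (nullP i x)) <= B ->
  (forall j, r + \sum_x lambda x * (ln (altQ j x) - ln (nullP i x)) <= B) ->
  exists2 C : R, 0 <= C & forall t, exists T : carrier (fp_prod (nseq t p)) -> R,
    [/\ is_test T, forall j, \sum_y T y * altQ j y <= expR (- (t%:R * r)) &
      expR (- (t%:R * (B + delta)) - C) <= \sum_y T y * nullP i y].
Proof.
move=> delta0 ld l0 null_le alt_le.
pose mu k := \sum_x lambda x * log_ratio i lambda k x.
pose v k := \sum_x lambda x * (log_ratio i lambda k x - mu k) ^+ 2.
have v0 k : 0 <= v k by apply: sumr_ge0 => x _; rewrite mulr_ge0 ?sqr_ge0 // ltW.
have mu_null : - B <= mu None.
  rewrite lerNl -sumrN; apply: le_trans null_le; apply: le_of_eq.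
  by apply: eq_bigr => x _; rewrite /log_ratio; ring.
have mu_alt j : r - B <= mu (Some j).
  rewrite lerBlDr -lerBlDl; apply: le_trans (alt_le j); rewrite lerD2l -sumrN.
  apply: le_of_eq.
  by apply: eq_bigr => x _; rewrite /log_ratio; ring.
pose V := \sum_k v k; have V0 : 0 <= V by exact: sumr_ge0.
(* The mean penalty will be [t * V / (2 * c)] plus a constant; [V + 1] keeps [c] positive when all
   variances vanish. *)
have [c c0 c_slope] : exists2 c : R, 0 < c & V / (2 * c) <= delta.
  have V1 : 0 < V + 1 by rewrite ltr_wpDl.
  exists ((V + 1) / delta); first by rewrite divr_gt0.
  rewrite ler_pdivrMr ?mulr_gt0 ?invr_gt0 //.
  have -> : delta * (2 * ((V + 1) / delta)) = 2 * (V + 1) by field; rewrite gt_eqF.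
  lra.
exists (\sum_(k : option J) c / 2).
  by rewrite sumr_ge0 // => k _; rewrite divr_ge0 // ltW.
move=> t.
have [L [Ld L0 LE LV]] := iid_moments ld l0 (fun k => erefl (mu k)) (fun k => erefl (v k)) t.
pose dev k y := log_ratio i L k y - t%:R * mu k.
(* Each summand dominates [|dev k y|] by the arithmetic-geometric mean inequality, while its mean
   needs only the variance. *)
pose pen y := \sum_k (dev k y ^+ 2 / c + c) / 2.
have pen_ge k y : - dev k y <= pen y.
  have term (d : R) : - d <= (d ^+ 2 / c + c) / 2.
    rewrite -subr_ge0 (_ : _ - _ = (d + c) ^+ 2 / c / 2).
      by rewrite !divr_ge0 ?sqr_ge0 // ltW.
    by field; rewrite gt_eqF.
  rewrite /pen (bigD1 k) //=; apply: le_trans (term _) _; rewrite lerDl.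
  apply: sumr_ge0 => k' _; rewrite !divr_ge0 ?addr_ge0 ?divr_ge0 ?sqr_ge0 //; exact: ltW.
(* With [pen_ge], the bounds [mu_null] and [mu_alt] make the exponent of [T] nonpositive and that of
   [T * altQ j / L] at most [- t * r]. *)
pose T y := expR (- (t%:R * B) - pen y - log_ratio i L None y).
have TP y : T y * nullP i y = L y * expR (- (t%:R * B) - pen y).
  rewrite -{1}(@lnK _ (nullP i y)) ?posrE ?nullP_gt0 // -{1}(@lnK _ (L y)) ?posrE //.
  by rewrite -!expRD; congr expR; rewrite /log_ratio; ring.
exists T; split.
- move=> y; rewrite expR_ge0 /= -expR0 ler_expR.
  have := pen_ge None y; rewrite /dev.
  have := ler_wpM2l (ler0n R t) mu_null; lra.
- move=> j; rewrite -[leRHS]mul1r -[X in _ <= X * _]Ld.2 mulr_suml.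
  apply: ler_sum => y _.
  rewrite -{1}(@lnK _ (altQ j y)) ?posrE ?altQ_gt0 // -{1}(@lnK _ (L y)) ?posrE //.
  rewrite /T -!expRD ler_expR /log_ratio.
  have := pen_ge (Some j) y; rewrite /dev /log_ratio.
  have := ler_wpM2l (ler0n R t) (mu_alt j); lra.
- under [leRHS]eq_bigr do rewrite TP.
  (* By Jensen only the mean of the penalty under [L] matters. *)
  apply: le_trans (jensen_expR _ Ld); rewrite ler_expR.
  under [leRHS]eq_bigr do rewrite mulrBr.
  rewrite sumrB -[X in _ <= X - _]mulr_suml Ld.2 mul1r.
  rewrite mulrDr opprD -addrA lerD2l -opprD lerN2.
  under eq_bigr do rewrite mulr_sumr; rewrite exchange_big /=.
  have -> : \sum_k \sum_y L y * ((dev k y ^+ 2 / c + c) / 2) =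
      t%:R * (V / (2 * c)) + \sum_(k : option J) c / 2.
    rewrite mulr_suml mulr_sumr -big_split /=; apply: eq_bigr => k _.
    rewrite (eq_bigr (fun y => L y * dev k y ^+ 2 * (c^-1 / 2) + L y * (c / 2))); last first.
      by move=> y _; ring.
    rewrite big_split /= -!mulr_suml LV Ld.2 mul1r; congr (_ + _).
    by field; rewrite gt_eqF.
  by rewrite lerD2r ler_wpM2l.
Qed.

End IidTest.

Lemma sum_pair {V : nmodType} {X Y : finType} (F : X * Y -> V) :
  \sum_z F z = \sum_x \sum_y F (x, y).
Proof. by rewrite pair_bigA; apply: eq_bigr => -[]. Qed.

(** * Composite nulls and transfer of tests *)

Section Tests.
Context {R : realType} {I J : finType}.
Implicit Types (p q : fampair R I J) (i : I) (gamma : J -> R).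

(** The uniform mixture of the tests for the single [i] keeps the type II bound and loses at most a
    factor [#|I|] in acceptance, absorbed as [ln N]. *)
Lemma composite_iid_test p (r B delta : R) : (0 < #|I|)%N -> 0 < delta ->
  (forall i, exists lambda : carrier p -> R, [/\ is_distr lambda, forall x, 0 < lambda x,
    \sum_x lambda x * (ln (lambda x) - ln (nullP i x)) <= B &
    forall j, r + \sum_x lambda x * (ln (altQ j x) - ln (nullP i x)) <= B]) ->
  exists2 C : R, 0 <= C & forall t, exists T : carrier (fp_prod (nseq t p)) -> R,
    [/\ is_test T, forall j, \sum_y T y * altQ j y <= expR (- (t%:R * r)) &
      forall i, expR (- (t%:R * (B + delta)) - C) <= \sum_y T y * nullP i y].
Proof.
move=> I0 delta0 lambdas; set N : R := #|I|%:R.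
have N0 : 0 < N by rewrite ltr0n.
have tests i : exists C : R, 0 <= C /\ forall t, exists T : carrier (fp_prod (nseq t p)) -> R,
    [/\ is_test T, forall j, \sum_y T y * altQ j y <= expR (- (t%:R * r)) &
      expR (- (t%:R * (B + delta)) - C) <= \sum_y T y * nullP i y].
  have [lambda [ld l0 null_le alt_le]] := lambdas i.
  by have [C C0 h] := iid_test delta0 ld l0 null_le alt_le; exists C.
have [C hC] := choice tests.
have lnN0 : 0 <= ln N by rewrite ln_ge0 // ler1n.
exists (\sum_i C i + ln N); first by rewrite addr_ge0 // sumr_ge0 // => i _; exact: (hC i).1.
move=> t; have [T hT] := choice (fun i => (hC i).2 t).
have T0 i y : 0 <= T i y by case: (hT i) => /(_ y)/andP[].
have T1 i y : T i y <= 1 by case: (hT i) => /(_ y)/andP[].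
have sumE (F : carrier (fp_prod (nseq t p)) -> R) :
    \sum_y N^-1 * (\sum_i T i y) * F y = N^-1 * \sum_i \sum_y T i y * F y.
  rewrite exchange_big /= mulr_sumr; apply: eq_bigr => y _.
  by rewrite -mulrA mulr_suml.
have avg (F : I -> R) M : (forall i, F i <= M) -> N^-1 * \sum_i F i <= M.
  move=> FM; rewrite mulrC ler_pdivrMr // mulrC -[N]/(#|I|%:R) mulr_natl -sumr_const.
  by apply: ler_sum => i _.
exists (fun y => N^-1 * \sum_i T i y); split=> [y|j|i].
- rewrite avg // andbT mulr_ge0 ?invr_ge0 ?(ltW N0) //.
  by apply: sumr_ge0 => i _.
- by rewrite sumE; apply: avg => i; case: (hT i).
- rewrite sumE opprD addrA expRD expRN lnK ?posrE // mulrC ler_wpM2l ?invr_ge0 ?(ltW N0) //.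
  have P_ge0 i' : 0 <= \sum_y T i' y * nullP i y.
    by apply: sumr_ge0 => y _; rewrite mulr_ge0 // ltW // nullP_gt0.
  rewrite [leRHS](bigD1 i) //= ler_wpDr ?sumr_ge0 //.
  have [_ _ h] := hT i; apply: le_trans h; rewrite ler_expR lerD2l lerN2.
  by rewrite (bigD1 i) //= lerDl sumr_ge0 // => i' _; exact: (hC i').1.
Qed.

Lemma upow_point k : exists z : carrier (fp_upow R I J k),
  [/\ forall F : carrier (fp_upow R I J k) -> R, \sum_z F z = F z,
      forall i, nullP i z = 2 ^+ k & forall j, altQ j z = 1].
Proof.
elim: k => [|k [z [zF zP zQ]]].
  by exists tt; split=> // F; rewrite big_unit addr0.
exists (tt, z); split=> [F|i|j] /=.
- by rewrite (@sum_pair _ unit (carrier (fp_upow R I J k))) big_unit addr0 zF.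
- by rewrite zP exprS.
- by rewrite zQ mulr1.
Qed.

(** The test is pulled back along the matrix at the single point of the power of [u]. Only
    acceptance under the null pays, as [u] has weight 2 on the null side and 1 on the other. *)
Lemma test_transfer k q p (T : carrier q -> R) :
  fp_le q (fp_tensor (fp_upow R I J k) p) -> is_test T ->
  exists T' : carrier p -> R, [/\ is_test T',
    forall j, \sum_x T' x * altQ j x <= \sum_y T y * altQ j y &
    forall i, \sum_y T y * nullP i y <= 2 ^+ k * \sum_x T' x * nullP i x].
Proof.
move=> [W [[W0 W1] WP WQ]] T01; have [z [zF zP zQ]] := upow_point k.
have T0 y : 0 <= T y by case/andP: (T01 y).
have T1 y : T y <= 1 by case/andP: (T01 y).
have pairE (F : carrier (fp_upow R I J k) * carrier p -> R) :
    \sum_w F w = \sum_x F (z, x).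
  by rewrite sum_pair zF.
have swap (F : carrier p -> R) :
    \sum_x (\sum_y T y * W y (z, x)) * F x = \sum_y T y * \sum_x W y (z, x) * F x.
  under eq_bigr do rewrite mulr_suml; rewrite exchange_big /=.
  by apply: eq_bigr => y _; rewrite mulr_sumr; apply: eq_bigr => x _; rewrite mulrA.
exists (fun x => \sum_y T y * W y (z, x)); split=> [x|j|i].
- rewrite sumr_ge0 => [|y _]; last by rewrite mulr_ge0.
  by apply: le_trans (W1 (z, x)); apply: ler_sum => y _; rewrite ler_piMl.
- rewrite swap; apply: ler_sum => y _; apply: ler_wpM2l => //.
  apply: le_trans (WQ j y); rewrite pairE /=;
  apply: le_of_eq.
  by apply: eq_bigr => x _; rewrite zQ mul1r.
- rewrite swap mulr_sumr; apply: ler_sum => y _; rewrite mulrCA; apply: ler_wpM2l => //.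
  apply: (le_trans (WP i y)); rewrite pairE mulr_sumr;
  apply: le_of_eq.
  by apply: eq_bigr => x _ /=; rewrite zP mulrCA.
Qed.

End Tests.

(** * Achievability and converse for the sequence *)

Section Achievability.
Context {R : realType} {I J : finType}.
Variables (a : nat -> fampair R I J) (k : nat -> nat).
Hypothesis I_gt0 : (0 < #|I|)%N.
Hypothesis a_gt0 : forall n, (0 < #|carrier (a n)|)%N.
Hypothesis a_geom : geometric_with a k.
Hypothesis k_sublinear : sublinear R k.
Hypothesis a_distr : forall n, normalized (a n).

(** Writing [n = m * t + rho], a test on [t] blocks is transferred to [a n]. Each block costs a
    factor [2 ^+ k m], whence the term [(k m)%:R * ln 2]. *)
Lemma sequence_test m (r B delta : R) : (0 < m)%N -> 0 <= r -> 0 <= B -> 0 < delta ->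
  (forall i, exists lambda : carrier (a m) -> R,
    [/\ is_distr lambda, forall x, 0 < lambda x,
      \sum_x lambda x * (ln (lambda x) - ln (nullP i x)) <= B &
      forall j, r + \sum_x lambda x * (ln (altQ j x) - ln (nullP i x)) <= B]) ->
  exists2 C : R, 0 <= C & forall n, exists T : carrier (a n) -> R,
    [/\ is_test T, forall j, \sum_x T x * altQ j x <= expR (- (n%:R / m%:R * r) + C) &
      forall i, expR (- (n%:R / m%:R * (B + delta + (k m)%:R * ln 2)) - C)
        <= \sum_x T x * nullP i x].
Proof.
move=> m0 r0 B0 delta0 lambdas; have l2 := @ln2_gt0 R.
have [C C0 tests] := composite_iid_test I_gt0 delta0 lambdas.
pose K : R := (\sum_(rho < m) k rho)%:R.
have K0 : 0 <= K by exact: ler0n.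
(* [K * ln 2] pays for the remainder [a rho], and [r] for rounding [n / m] down to [t]. *)
exists (C + K * ln 2 + r); first by rewrite !addr_ge0 // mulr_ge0 // ltW.
move=> n; set t := (n %/ m)%N; set rho := (n %% m)%N.
have mR : 0 < m%:R :> R by rewrite ltr0n.
have t_le : t%:R <= n%:R / m%:R :> R.
  by rewrite ler_pdivlMr // -natrM ler_nat leq_trunc_div.
have t_ge : n%:R / m%:R - 1 <= t%:R :> R.
  rewrite lerBlDr ler_pdivrMr // natr1 -natrM ler_nat ltnW //.
  by rewrite {1}(divn_eq n m) mulSn addnC ltn_add2r ltn_mod.
have k_rho : (k rho)%:R <= K :> R.
  by rewrite ler_nat (bigD1 (Ordinal (ltn_pmod n m0))) //= leq_addr.
have [T [T01 TQ TP]] := tests t.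
have := @a_geom (rho :: nseq t m) isT.
rewrite /= !big_cons !big_nseq !iter_addn_0 map_nseq.
have -> : (rho + m * t = n)%N by rewrite [RHS](divn_eq n m) addnC mulnC.
move=> [le_n _].
(* Ignoring the remainder factor is free, its measures being normalized. *)
pose T2 (y : carrier (a rho) * carrier (fp_prod (nseq t (a m)))) := T y.2.
have T2_test : @is_test R I J (fp_tensor (a rho) (fp_prod (nseq t (a m)))) T2.
  by move=> y; exact: T01.
have T2E (F : carrier (a rho) -> R) G : \sum_x F x = 1 ->
    \sum_y T2 y * (F y.1 * G y.2) = \sum_y T y * G y.
  move=> F1; rewrite -[RHS]mul1r -F1 big_distrlr /= pair_bigA /=.
  by apply: eq_bigr => y _; rewrite mulrCA.
have [T' [T'_test T'Q T'P]] := test_transfer le_n T2_test.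
exists T'; split=> // [j|i].
- apply: le_trans (T'Q j) _; rewrite /= (T2E (altQ j) (altQ j));
    last exact: ((a_distr rho).2 j).2.
  apply: le_trans (TQ j) _; rewrite ler_expR.
  have := ler_wpM2r r0 t_ge; have : 0 <= K * ln 2 by rewrite mulr_ge0 // ltW.
  by lra.
- have := T'P i; rewrite /= (T2E (nullP i) (nullP i)); last exact: ((a_distr rho).1 i).2.
  move=> /(le_trans (TP i)); set u := (_ + _)%N; set PT := \sum_x _ => h.
  have u2 : 2 ^+ u = expR (u%:R * ln 2) :> R by rewrite expRM_natl lnK // posrE.
  rewrite u2 -ler_pdivrMl ?expR_gt0 // -expRN -expRD in h; apply: le_trans h.
  rewrite ler_expR /u natrD natrM.
  have h1 : 0 <= B + delta + (k m)%:R * ln 2.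
    by rewrite !addr_ge0 // ?(ltW delta0) // mulr_ge0 // ltW.
  have := ler_wpM2r h1 t_le; have := ler_wpM2r (ltW l2) k_rho.
  by lra.
Qed.

Lemma eps_test (r S delta : R) : 0 <= r -> 0 <= S -> 0 < delta ->
  (forall alpha i gamma, 1 < alpha -> is_distr gamma ->
    (alpha - 1) / alpha * (r - renyi_rate a alpha%:E i gamma) <= S) ->
  exists2 C : R, 0 <= C & forall n, exists T : carrier (a n) -> R,
    [/\ is_test T, forall j, \sum_x T x * altQ j x <= 2 `^ (- (n%:R * r) + C) &
      forall i, 2 `^ (- (n%:R * S) - (n%:R * delta + C)) <= \sum_x T x * nullP i x].
Proof.
move=> r0 S0 delta0 rateS; have l2 := @ln2_gt0 R.
have [m m0 k_small] : exists2 m : nat, (0 < m)%N & (k m)%:R / m%:R <= delta / 4.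
  have delta4 : 0 < delta / 4 by rewrite divr_gt0.
  have [N _ HN] := (@cvgrPdist_le _ _ _ _ _ _ _).1 k_sublinear _ delta4.
  exists N.+1 => //; have := HN N.+1 (leqnSn N); rewrite sub0r normrN.
  by apply: le_trans; exact: ler_norm.
have mR : 0 < m%:R :> R by rewrite ltr0n.
set kappa := (k m)%:R / m%:R in k_small.
have kappa0 : 0 <= kappa by rewrite divr_ge0.
have kE : (k m)%:R = kappa * m%:R by rewrite /kappa divfK // gt_eqF.
(* [delta] is spent in quarters: the block error [kappa] in [M], the loss [1 / c], the slack of the
   iid test, and the powers of [u]. *)
set c := (S + delta / 4) / (S + delta / 2).
have Sd2 : 0 < S + delta / 2 by rewrite ltr_wpDl // divr_gt0.
have Sd4 : 0 < S + delta / 4 by rewrite ltr_wpDl // divr_gt0.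
have c0 : 0 < c by rewrite divr_gt0.
have c1 : c < 1 by rewrite ltr_pdivrMr // mul1r; lra.
(* The factor [m * ln 2] converts bits per step to nats per block. *)
set M := m%:R * ln 2 * (S + kappa).
have M0 : 0 <= M by rewrite !mulr_ge0 ?addr_ge0 // ltW.
set B := M / c.
have B0 : 0 <= B by rewrite divr_ge0 // ltW.
have cE : c * (S + delta / 2) = S + delta / 4 by rewrite divfK // gt_eqF.
have B_le : B <= m%:R * ln 2 * (S + delta / 2).
  rewrite ler_pdivrMr // -[leRHS]mulrA [X in _ <= _ * X]mulrC cE.
  by rewrite ler_wpM2l ?mulr_ge0 ?(ltW l2) // lerD2l.
have r'0 : 0 <= m%:R * ln 2 * r by rewrite !mulr_ge0 // ltW.
have delta'0 : 0 < m%:R * ln 2 * (delta / 4) by rewrite !mulr_gt0 // divr_gt0.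
have lambdas i := block_distribution (i := i) (r := m%:R * ln 2 * r)
  (a_gt0 m) (a_distr m) c0 c1 M0.
have [|C C0 tests] := sequence_test m0 r'0 B0 delta'0.
  move=> i; apply: lambdas => alpha gamma a1 gd.
  have a0 : 0 < alpha by exact: lt_trans a1.
  set D := renyi_div _ _ _ _; set s := (alpha - 1) / alpha.
  have s0 : 0 < s by rewrite divr_gt0 // subr_gt0.
  have -> : s * (m%:R * ln 2 * r - ln 2 * D) = m%:R * ln 2 * (s * (r - D / m%:R)).
    by field; rewrite gt_eqF.
  rewrite /M ler_wpM2l ?mulr_ge0 ?(ltW l2) //.
  (* Multiplied by [s], the error of the rate is [kappa] for every order. *)
  have := renyi_rate_dist a_gt0 a_geom k_sublinear i a1 gd m0.
  rewrite -/D -/kappa ler_distl => /andP[D_ge _].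
  apply: le_trans (lerD (rateS alpha i gamma a1 gd) (lexx kappa)); rewrite -/s.
  have -> : kappa = s * (alpha / (alpha - 1) * kappa).
    by rewrite /s; field; rewrite !gt_eqF // subr_gt0.
  rewrite -mulrDr ler_pM2l //; lra.
have powE (x : R) : 2 `^ x = expR (x * ln 2) by rewrite /powR pnatr_eq0.
exists (C / ln 2); first by rewrite divr_ge0 // ltW.
move=> n; have [T [T01 TQ TP]] := tests n; exists T; split=> // [j|i].
- apply: le_trans (TQ j) _; rewrite powE ler_expR mulrDl divfK ?gt_eqF //.
  rewrite lerD2r;
  apply: le_of_eq.
  by field; rewrite gt_eqF.
- apply: le_trans (TP i); rewrite powE ler_expR.
  have -> : (- (n%:R * S) - (n%:R * delta + C / ln 2)) * ln 2 =
      - (n%:R / m%:R * (m%:R * ln 2 * (S + delta))) - C.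
    by field; rewrite !gt_eqF.
  rewrite lerD2r lerN2 ler_wpM2l ?divr_ge0 //.
  have : (k m)%:R * ln 2 <= m%:R * ln 2 * (delta / 4).
    have -> : (k m)%:R * ln 2 = m%:R * ln 2 * kappa by rewrite kE; ring.
    by rewrite ler_wpM2l ?mulr_ge0 ?(ltW l2).
  lra.
Qed.

Lemma ex_minimizer (E : nat -> R) n :
  exists l, forall l', (l' <= n)%N -> E l <= E l'.
Proof.
have [l _ min_l] := arg_minP (fun l : 'I_n.+1 => E l) (isT : xpredT ord0).
by exists l => l' l'n; exact: (min_l (Ordinal (l'n : (l' < n.+1)%N)) isT).
Qed.

(* The tests for slack [1/(l+1)] are diagonalised by choosing, for each [n], the
   index [l <= n] with the smallest total error. *)
Lemma diagonal_error (C : nat -> R) : (forall l, 0 <= C l) ->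
  exists l : nat -> nat,
    little_o_n (fun n => n%:R * (l n).+1%:R^-1 + C (l n)).
Proof.
move=> C0; pose E n l : R := n%:R * l.+1%:R^-1 + C l.
have E0 n l : 0 <= E n l by rewrite addr_ge0 // mulr_ge0 ?invr_ge0.
have [l lE] := choice (fun n => ex_minimizer (E n) n).
exists l; apply/cvgrPdist_le => e e0.
have e2 : 0 < e / 2 by rewrite divr_gt0.
have [N _ HN] := near_infty_natSinv_lt (PosNum e2).
have {}HN : N.+1%:R^-1 <= e / 2 by apply: ltW; exact: (HN N (leqnn N)).
near=> n.
have n0 : 0 < n%:R :> R by rewrite ltr0n; near: n; exists 1%N.
have nN : (N <= n)%N by near: n; exists N.
have nC : C N / (e / 2) <= n%:R by near: n; exact: nbhs_infty_ger.
rewrite sub0r normrN ger0_norm; last by rewrite divr_ge0 // E0.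
rewrite ler_pdivrMr //; apply: le_trans (lE n N nN) _; rewrite /E.
move: nC; rewrite ler_pdivrMr // => nC.
apply: le_trans (lerD (ler_wpM2l (ltW n0) HN) nC) _.
by rewrite -mulrDr -splitr mulrC.
Unshelve. all: by end_near. Qed.

Lemma achievable_of_rates (r S : R) : 0 <= r -> 0 <= S ->
  (forall alpha i gamma, 1 < alpha -> is_distr gamma ->
    (alpha - 1) / alpha * (r - renyi_rate a alpha%:E i gamma) <= S) ->
  achievable a r S.
Proof.
move=> r0 S0 rateS.
have tests l : exists C : R, 0 <= C /\ forall n, exists T : carrier (a n) -> R,
    [/\ is_test T, forall j, \sum_x T x * altQ j x <= 2 `^ (- (n%:R * r) + C) &
      forall i, 2 `^ (- (n%:R * S) - (n%:R * l.+1%:R^-1 + C)) <= \sum_x T x * nullP i x].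
  have [|C C0 h] := @eps_test r S l.+1%:R^-1 r0 S0 _ rateS; first by rewrite invr_gt0.
  by exists C.
have [C hC] := choice tests.
have C0 l : 0 <= C l := (hC l).1.
have [l l_small] := diagonal_error C0.
pose T n := sval (cid ((hC (l n)).2 n)).
have hT n : [/\ is_test (T n),
    forall j, \sum_x T n x * altQ j x <= 2 `^ (- (n%:R * r) + C (l n)) &
    forall i, 2 `^ (- (n%:R * S) - (n%:R * (l n).+1%:R^-1 + C (l n))) <=
      \sum_x T n x * nullP i x].
  exact: svalP (cid ((hC (l n)).2 n)).
have pow_mono (x y : R) : x <= y -> 2 `^ x <= 2 `^ y.
  by move=> xy; rewrite ler_powR // ler1n.
exists T; split; first by move=> n; case: (hT n).
exists (fun n => n%:R * (l n).+1%:R^-1 + C (l n)),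
  (fun n => - (n%:R * (l n).+1%:R^-1 + C (l n))); split=> [//||n|n].
- rewrite /little_o_n; under eq_fun do rewrite mulNr.
  by rewrite -oppr0; apply: cvgN; exact: l_small.
- have [_ TQ _] := hT n; apply: bigmax_le => [|j _]; first exact: powR_ge0.
  by apply: le_trans (TQ j) _; apply: pow_mono; rewrite lerD2l lerDr mulr_ge0 ?invr_ge0.
- have [_ _ TP] := hT n; rewrite lerBrDr -lerBrDl; apply: bigmax_le => [|i _].
    (* The default 0 of the maximum requires the acceptance bound to be at most 1: its exponent is
       nonpositive. *)
    rewrite subr_ge0 -[leRHS](powRr0 2); apply: pow_mono.
    rewrite -opprD oppr_le0 !addr_ge0 ?mulr_ge0 ?invr_ge0 //.
  by rewrite lerD2l lerN2; exact: TP.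
Qed.

(* A test is a substochastic map to a point, so data processing bounds its error
   probabilities. *)
Lemma achievable_ge (r S : R) : achievable a r S ->
  0 <= S /\ forall alpha i gamma, 1 < alpha -> is_distr gamma ->
    (alpha - 1) / alpha * (r - renyi_rate a alpha%:E i gamma) <= S.
Proof.
move=> [T [T01 [e [e' [e_small e'_small typeII typeI]]]]]; have l2 := @ln2_gt0 R.
have pow_gt0 (x : R) : 0 < 2 `^ x by exact: powR_gt0.
have TP n i : 2 `^ (- (n%:R * S) + e' n) <= \sum_x T n x * nullP i x.
  apply: le_trans (typeI n) _; rewrite lerBlDl -lerBlDr.
  exact: (le_bigmax (0 : R) (fun i => 1 - \sum_x T n x * nullP i x) i).
have TQ n j : \sum_x T n x * altQ j x <= 2 `^ (- (n%:R * r) + e n).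
  apply: le_trans (typeII n).
  exact: (le_bigmax (0 : R) (fun j => \sum_x T n x * altQ j x) j).
have log2_pow (x : R) : log2 (2 `^ x) = x by rewrite /log2 ln_powR mulfK // gt_eqF.
split.
  have : - S + 0 <= 0.
    apply: (@ler_cvg_to _ \oo _ R (fun n => - S + e' n / n%:R) (fun=> 0)).
    - by apply: cvgD; [exact: cvg_cst|exact: e'_small].
    - exact: cvg_cst.
    - exists 1%N => // n /= n0; have nR : 0 < n%:R :> R by rewrite ltr0n.
      rewrite -(ler_pM2r nR) mul0r mulrDl divfK ?gt_eqF // mulNr mulrC.
      rewrite -[leLHS]log2_pow /log2 pmulr_lle0 ?invr_gt0 //; apply: ln_le0.
      apply: le_trans (typeI n) _; rewrite gerBl; exact: bigmax_ge_id.
  by rewrite addr0 oppr_le0.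
move=> alpha i gamma a1 gd; have a0 : 0 < alpha by exact: lt_trans a1.
have a1' : 0 < alpha - 1 by rewrite subr_gt0.
(* Taking the guaranteed bounds as weights, common to all indices, makes [renyi_f] of the point
   explicit for every [gamma]. *)
pose q n : fampair R I J := @Fampair R I J unit
  (fun _ _ => 2 `^ (- (n%:R * S) + e' n)) (fun _ _ => 2 `^ (- (n%:R * r) + e n))
  (fun _ _ => pow_gt0 _) (fun _ _ => pow_gt0 _).
have q_le n : fp_le (q n) (a n).
  exists (fun _ => T n); split=> [|i' y|j y]; [split=> [_ x|x]|exact: TP|exact: TQ].
    by case/andP: (T01 n x).
  by rewrite big_unit addr0; case/andP: (T01 n x).
have fq n : log2 (renyi_f alpha i gamma (q n)) =
    alpha * (- (n%:R * S) + e' n) + (1 - alpha) * (- (n%:R * r) + e n).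
  rewrite /log2 renyi_fE big_unit addr0 expRK /= -mulr_suml gd.2 mul1r !ln_powR.
  by field; rewrite gt_eqF.
have h : r - alpha / (alpha - 1) * S <= renyi_rate a alpha%:E i gamma.
  pose slack n := alpha / (alpha - 1) * (e' n / n%:R) - e n / n%:R.
  have slack0 : slack n @[n --> \oo] --> (0 : R).
    rewrite -[X in _ --> X](subr0 0) -{1}(mulr0 (alpha / (alpha - 1))).
    by apply: cvgB; [apply: cvgM; [exact: cvg_cst|exact: e'_small]|exact: e_small].
  rewrite renyi_rateE // -[leLHS]addr0.
  apply: (@ler_cvg_to _ \oo _ R (fun n => r - alpha / (alpha - 1) * S + slack n)
    (renyi_seq a alpha%:E i gamma)).
  - by apply: cvgD; [exact: cvg_cst|exact: slack0].
  - exact: (renyi_seq_cvg a_gt0 a_geom k_sublinear a1 gd).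
  exists 1%N => // n /= n0; have nR : 0 < n%:R :> R by rewrite ltr0n.
  have log_le : log2 (renyi_f alpha i gamma (q n)) <= log2 (renyi_f alpha i gamma (a n)).
    rewrite /log2 ler_pM2r ?invr_gt0 // ler_ln ?posrE ?renyi_f_gt0 ?card_unit //.
    by apply: renyi_f_le => //; exact: ltW.
  rewrite fq in log_le; rewrite /renyi_seq renyi_divE // -(ler_pM2l nR).
  rewrite [leRHS]mulrA mulfV ?gt_eqF // mul1r mulrC ler_pdivlMl //.
  apply: le_trans log_le; apply: le_of_eq.
  by rewrite /slack; field; rewrite !gt_eqF.
move: h; rewrite lerBlDr -lerBlDl => h.
rewrite mulrC -ler_pdivlMr ?divr_gt0 //; apply: le_trans h _.
by rewrite invf_div mulrC.
Qed.

End Achievability.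

(** * Attainment of the maximum over null index and weights *)

Section MaximalRate.
Context {R : realType} {I J : finType}.

Lemma renyi_div_cvg {T : Type} {F : set_system T} {FF : Filter F} (u : T -> J -> R)
    gamma alpha i (p : fampair R I J) : 1 < alpha -> (0 < #|carrier p|)%N ->
  (forall j, u t j @[t --> F] --> gamma j) ->
  renyi_div alpha%:E i (u t) p @[t --> F] --> renyi_div alpha%:E i gamma p.
Proof.
move=> a1 p0 u_cvg; rewrite renyi_divE //; under eq_fun do rewrite renyi_divE //.
apply: cvgM; first exact: cvg_cst.
apply: cvgM; last exact: cvg_cst.
apply: continuous_cvg; first by apply: continuous_ln; exact: renyi_f_gt0.
rewrite renyi_fE; under eq_fun do rewrite renyi_fE.
apply: cvg_sumr => x; apply: continuous_cvg; first exact: continuous_expR.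
apply: cvgD; first exact: cvg_cst.
apply: cvgM; first exact: cvg_cst.
by apply: cvg_sumr => j; apply: cvgM; [exact: u_cvg|exact: cvg_cst].
Qed.

Section ProductTopology.
Import ArrowAsProduct.

Lemma renyi_div_continuous alpha i (p : fampair R I J) : 1 < alpha ->
  (0 < #|carrier p|)%N -> continuous (fun gamma : J -> R => renyi_div alpha%:E i gamma p).
Proof.
move=> a1 p0 gamma; apply: (@renyi_div_cvg (J -> R) (nbhs gamma) _ (fun eta => eta)) => // j.
exact: (@continuous_coord R J j gamma).
Qed.

Lemma renyi_div_scaled_continuous alpha i (p : fampair R I J) (c : R) : 1 < alpha ->
  (0 < #|carrier p|)%N ->
  continuous (fun gamma : J -> R => - (renyi_div alpha%:E i gamma p / c)).
Proof.
move=> a1 p0 gamma; apply: (@cvgN _ _ _ (nbhs gamma)).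
apply: (@cvgM _ _ (nbhs gamma)); last exact: cvg_cst.
exact: (@renyi_div_continuous alpha i p a1 p0 gamma).
Qed.

End ProductTopology.

Variables (a : nat -> fampair R I J) (k : nat -> nat).
Hypothesis I_gt0 : (0 < #|I|)%N.
Hypothesis J_gt0 : (0 < #|J|)%N.
Hypothesis a_gt0 : forall n, (0 < #|carrier (a n)|)%N.
Hypothesis a_geom : geometric_with a k.
Hypothesis k_sublinear : sublinear R k.

(** Divergences of single elements are continuous in [gamma] and approximate the rate uniformly on
    the simplex. *)
Lemma renyi_rate_min alpha i : 1 < alpha -> exists2 gamma, is_distr gamma &
  forall gamma', is_distr gamma' ->
    renyi_rate a alpha%:E i gamma <= renyi_rate a alpha%:E i gamma'.
Proof.
move=> a1; have [|gamma gd gmax] :=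
    @simplex_max R J (fun gamma => - renyi_rate a alpha%:E i gamma) J_gt0; last first.
  exists gamma; first exact: gd.
  by move=> gamma' gd'; rewrite -lerN2; exact: gmax.
move=> e e0; have C0 : 0 < alpha / (alpha - 1).
  by rewrite divr_gt0 ?subr_gt0 // (lt_trans ltr01).
have eC : 0 < e / (alpha / (alpha - 1)) by rewrite divr_gt0.
have [N _ HN] := (@cvgrPdist_le _ _ _ _ _ _ _).1 k_sublinear _ eC.
exists (fun gamma => - (renyi_div alpha%:E i gamma (a N.+1) / N.+1%:R)).
  exact: (@renyi_div_scaled_continuous alpha i (a N.+1) N.+1%:R a1 (a_gt0 N.+1)).
move=> gamma gd; rewrite opprK addrC.
apply: le_trans (renyi_rate_dist a_gt0 a_geom k_sublinear i a1 gd (ltn0Sn N)) _.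
rewrite mulrC -ler_pdivlMr //; apply: le_trans (HN N.+1 (leqnSn N)).
by rewrite sub0r normrN ler_norm.
Qed.

Lemma renyi_rate_maximum alpha r : 1 <= alpha -> exists m : R, is_maximum
  [set v | exists (i : I) (gamma : J -> R), is_distr gamma /\
     v = (alpha - 1) / alpha * (r - renyi_rate a alpha%:E i gamma)] m.
Proof.
have [i0 _] := card_gt0P I_gt0; have [j0 _] := card_gt0P J_gt0.
rewrite le_eqVlt => /orP[/eqP <-|a1].
  exists 0; split=> [|_ [i [gamma [_ ->]]]]; last by rewrite subrr !mul0r.
  exists i0, (fun j => (j == j0)%:R); rewrite subrr !mul0r; split=> //; split=> //.
  by rewrite (bigD1 j0) //= eqxx big1 ?addr0 // => j /negbTE ->.
have gammas i : exists gamma : J -> R, is_distr gamma /\ forall gamma', is_distr gamma' ->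
    renyi_rate a alpha%:E i gamma <= renyi_rate a alpha%:E i gamma'.
  by have [gamma gd gmin] := renyi_rate_min i a1; exists gamma.
have [g hg] := choice gammas.
have [i _ imin] := arg_minP (fun i => renyi_rate a alpha%:E i (g i)) (isT : xpredT i0).
exists ((alpha - 1) / alpha * (r - renyi_rate a alpha%:E i (g i))); split.
  by exists i, (g i); split=> //; exact: (hg i).1.
move=> _ [i' [gamma [gd ->]]]; apply: ler_wpM2l.
  by rewrite divr_ge0 ?subr_ge0 ?(ltW a1) // (le_trans ler01) // ltW.
by rewrite lerD2l lerN2; apply: le_trans (imin i' isT) _; exact: (hg i').2.
Qed.

End MaximalRate.

Unset Implicit Arguments.

Theorem proposition5p32 (R : realType) (I J : finType)
    (I_neq0 : (0 < #|I|)%N) (J_neq0 : (0 < #|J|)%N)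
    (a : nat -> fampair R I J)
    (a_geom : approximately_geometric a)
    (P_distr : forall n i, is_distr (@nullP R I J (a n) i))
    (Q_distr : forall n j, is_distr (@altQ R I J (a n) j)) :
  [/\ forall (alpha : \bar R) (i : I) (gamma : J -> R),
        (1 < alpha)%E -> is_distr gamma -> cvgn (renyi_seq a alpha i gamma),
      forall (i : I) (gamma : J -> R), is_distr gamma ->
        cvg (renyi_rate a b%:E i gamma @[b --> (1 : R)^'+]),
      forall (alpha : R) (i : I) (gamma : J -> R),
        1 < alpha -> is_distr gamma ->
        cvgn (renyi_f_root a alpha i gamma) /\
        renyi_rate a alpha%:E i gamma =
          (alpha - 1)^-1 * log2 (renyi_f_rate a alpha i gamma) &
      forall r : R, 0 <= r ->
        exists (S : R) (M : R -> R),
          [/\ strong_converse_exponent a r S,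
              forall alpha : R, 1 <= alpha ->
                is_maximum
                  [set v | exists (i : I) (gamma : J -> R), is_distr gamma /\
                     v = (alpha - 1) / alpha * (r - renyi_rate a alpha%:E i gamma)]
                  (M alpha) &
              supremums [set M alpha | alpha in [set x : R | 1 <= x]] S]].
Proof.
have [a_gt0 [k [k_sublinear geom]]] := a_geom.
have a_distr n : normalized (a n) by split; [exact: P_distr|exact: Q_distr].
split=> [[alpha||] i gamma a1 gd|i gamma gd|alpha i gamma a1 gd|r r0].
- by apply: (renyi_seq_cvg a_gt0 geom k_sublinear); rewrite // -lte_fin.
- exact: (renyi_seq_pinfty_cvg a_gt0 geom k_sublinear).
- by move: a1; rewrite ltNge leNye.
- exact: (renyi_rate_cvg_at1 a_gt0 geom k_sublinear a_distr).
- split; last exact: (renyi_f_rate_log a_gt0 geom k_sublinear).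
  exact: cvgP (renyi_f_root_cvg a_gt0 geom k_sublinear a1 gd).
have maxima (alpha : R) : exists m : R, 1 <= alpha -> is_maximum
    [set v | exists (i : I) (gamma : J -> R), is_distr gamma /\
       v = (alpha - 1) / alpha * (r - renyi_rate a alpha%:E i gamma)] m.
  have [a1|_] := boolP (1 <= alpha); last by exists 0.
  by have [m hm] := renyi_rate_maximum I_neq0 J_neq0 a_gt0 geom k_sublinear r a1; exists m.
have [M hM] := choice maxima.
set A := [set M alpha | alpha in [set x : R | 1 <= x]].
(* Order 1 makes the supremum nonnegative, as the construction of tests requires. *)
have M1 : M 1 = 0.
  by have [[i [gamma [_ ->]]] _] := hM 1 (lexx 1); rewrite subrr !mul0r.
have A_ne : A !=set0 by exists (M 1); exists 1 => //=.
(* The rates are nonnegative and the prefactors lie in [[0, 1]]. *)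
have A_le_r : ubound A r.
  move=> _ [alpha /= a1 <-]; have [[i [gamma [gd ->]]] _] := hM alpha a1.
  move: a1; rewrite [1 <= _]le_eqVlt => /orP[/eqP <-|a1]; first by rewrite subrr !mul0r.
  have a0 : 0 < alpha by exact: lt_trans a1.
  have s0 : 0 <= (alpha - 1) / alpha by rewrite divr_ge0 ?subr_ge0 ?ltW.
  have s1 : (alpha - 1) / alpha <= 1 by rewrite ler_pdivrMr // mul1r lerBlDr lerDl.
  have rate0 := renyi_rate_ge0 a_gt0 geom k_sublinear a_distr i a1 gd.
  apply: (@le_trans _ _ ((alpha - 1) / alpha * r)); last by rewrite ler_piMl.
  by rewrite ler_wpM2l // lerBlDr lerDl.
have A_sup : has_sup A by split; last by exists r.
have sup_ge := sup_upper_bound A_sup.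
have sup0 : 0 <= sup A by rewrite -M1; apply: sup_ge; exists 1 => //=.
exists (sup A), M; split=> //; last first.
  by split=> // y Ay; exact: ge_sup.
split.
  apply: (achievable_of_rates I_neq0 a_gt0 geom k_sublinear a_distr r0 sup0).
  move=> alpha i gamma a1 gd; apply: (@le_trans _ _ (M alpha)).
    by apply: (hM alpha (ltW a1)).2; exists i, gamma.
  by apply: sup_ge; exists alpha => //=; exact: ltW.
move=> S' ach; have [S'0 rates] := achievable_ge a_gt0 geom k_sublinear ach.
apply: ge_sup => // _ [alpha /= a1 <-].
have [[i [gamma [gd ->]]] _] := hM alpha a1.
(* At order 1 the required bound is [0 <= S']. *)
move: a1; rewrite [1 <= _]le_eqVlt => /orP[/eqP <-|a1]; last exact: rates.
by rewrite subrr !mul0r.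
Qed.
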